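(* (ZFC) For every singular cardinal $\mu$ and every sequence $\bar p=\langle p_\delta:\delta<\operatorname{cf}(\mu)\rangle$ of partitions $p_\delta:[\mu^+]^2\to n_\delta$ with $n_\delta<\omega$, $\Pr_1(\mu^+,\mu^+,\operatorname{cf}(\mu),\operatorname{cf}(\mu))_{\bar p}$ holds.
   Context: $\Pr_1(\kappa,\mu,\lambda,\chi)_p$ for $p:[\kappa]^2\to\theta$: there is $f:[\kappa]^2\to\lambda$ such that for every $\xi<\chi$, every family $\mathcal A\subseteq[\kappa]^{<\xi}$ of $\mu$ pairwise disjoint nonempty sets, and every $\zeta\in\lambda^\theta$, there are $a,b\in\mathcal A$ with $\max a<\min b$ and $f(\alpha,\beta)=\zeta(p(\alpha,\beta))$ for all $\alpha\in a,\beta\in b$. With a sequence $\bar p=\langle p_\delta\rangle$: a single $f$ witnesses this for every $p_\delta$. *)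

(* Defs.v *)
(* Cardinals/ordinals are modelled by well-ordered types;
   cardinality comparison by existence of injections. *)
From Stdlib Require Import Classical.

Definition inj (A B : Type) : Prop := exists f : A -> B, forall x y, f x = f y -> x = y.

Definition is_wo {T : Type} (lt : T -> T -> Prop) : Prop :=
  (forall x, ~ lt x x) /\
  (forall x y z, lt x y -> lt y z -> lt x z) /\
  (forall x y, lt x y \/ x = y \/ lt y x) /\
  well_founded lt.

Definition initial_ordinal {T : Type} (lt : T -> T -> Prop) : Prop :=
  is_wo lt /\ forall x : T, ~ inj T {y : T | lt y x}.

Definition cofinal_map {D T : Type} (lt : T -> T -> Prop) (h : D -> T) : Prop :=
  forall x : T, exists d : D, lt x (h d).

Definition infinite_cardinal {M : Type} (ltM : M -> M -> Prop) : Prop :=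
  initial_ordinal ltM /\ inj nat M.

Definition is_cof {M C : Type} (ltM : M -> M -> Prop) (ltC : C -> C -> Prop) : Prop :=
  initial_ordinal ltC /\
  (exists h : C -> M, cofinal_map ltM h) /\
  (forall (D : Type) (h : D -> M), cofinal_map ltM h -> inj C D).

Definition is_successor_of (M : Type) {K : Type} (ltK : K -> K -> Prop) : Prop :=
  is_wo ltK /\ (forall x : K, inj {y : K | ltK y x} M) /\ ~ inj K M.

(* Pr_1(kappa, kappa, lambda, lambda)_{p-bar} where kappa = (K,ltK),
   lambda = (C,ltC), p-bar = <p_delta : delta < lambda>, p_delta : [kappa]^2 -> n delta.
   The range lambda of f and the index set of the sequence are both C;
   the bound xi < chi = lambda also ranges over C.  A family of kappa many
   pairwise disjoint nonempty sets is given as an indexed family a : K -> (K -> Prop). *)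
Definition Pr1_seq {K C : Type} (ltK : K -> K -> Prop) (ltC : C -> C -> Prop)
    (n : C -> nat) (p : C -> K -> K -> nat) : Prop :=
  exists f : K -> K -> C,
    forall (delta : C) (xi : C) (a : K -> K -> Prop) (zeta : nat -> C),
      (forall i, exists x, a i x) ->
      (forall i j x, i <> j -> a i x -> a j x -> False) ->
      (forall i, inj {x : K | a i x} {c : C | ltC c xi}) ->
      exists i j : K,
        (forall al be, a i al -> a j be -> ltK al be) /\
        (forall al be, a i al -> a j be -> f al be = zeta (p delta al be)).

(* Main.v *)
(** Write [kappa = cf mu].  A scale, i.e. a sequence [F_a] ([a < mu^+]) increasing and
    cofinal modulo bounded sets in a product of ordinals [L_i] ([i < kappa]) whose
    cofinalities increase fast to [mu], yields the colouring: if [G(a, b)] is the last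
    [i] with [F_b(i) <= F_a(i)], then for every family of [mu^+] disjoint blocks of size
    [< kappa] and every large [i] there are blocks [A < B] with [G] constantly [i] on
    [A x B].  Reading [i] as a code of [delta] and of a finite sequence of colours turns
    [G] into a colouring that works for all [p_delta] simultaneously.

    The scale comes from pcf theory.  In a product of successor cardinals one builds an
    increasing sequence [f_a] that at limits [d] dominates [f] along a small club of [d].
    Club guessing then gives the bounding projection property: projecting to sets
    [S(i)] of bounded size, some projection of an [f_a] bounds the whole sequence.  This
    property yields a least upper bound [g], its exactness, and [cf g(i) -> mu]; thinning
    out the index set gives the scale.  Ordinals and functions all live in [M] itself. *)

From Stdlib Require Import Classical ClassicalEpsilon FunctionalExtensionality.
From Stdlib Require Import Arith Lia List.
Require Import Defs.

(** * Choice functions for relations *)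

Lemma fun_choice {A B : Type} (R : A -> B -> Prop) :
  (forall x, exists y, R x y) -> exists f : A -> B, forall x, R x (f x).
Proof.
  intros H. exists (fun x => proj1_sig (constructive_indefinite_description _ (H x))).
  intros x. exact (proj2_sig (constructive_indefinite_description _ (H x))).
Qed.

Lemma fun_choice_on {A B : Type} (P : A -> Prop) (R : A -> B -> Prop) :
  inhabited B ->
  (forall x, P x -> exists y, R x y) -> exists f : A -> B, forall x, P x -> R x (f x).
Proof.
  intros [b] H. apply (fun_choice (fun x y => P x -> R x y)).
  intros x. destruct (classic (P x)) as [px|npx].
  - destruct (H x px) as [y hy]. exists y; auto.
  - exists b; tauto.
Qed.

(** * Well-orders *)

Record WO := MkWO { car :> Type; lt : car -> car -> Prop; wo_ax : is_wo lt }.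
Arguments lt {w} _ _.
Definition le {X : WO} (x y : X) : Prop := ~ lt y x.
Notation "x << y" := (lt x y) (at level 70, no associativity).
Notation "x <<= y" := (le x y) (at level 70, no associativity).
Definition seg {X : WO} (x : X) : X -> Prop := fun y => y << x.
Definition full (X : Type) : X -> Prop := fun _ => True.

Section Order.
Context {X : WO}.
Implicit Types x y z : X.

Lemma lt_irr x : ~ x << x.
Proof. destruct (wo_ax X) as [H _]. apply H. Qed.
Lemma lt_tr x y z : x << y -> y << z -> x << z.
Proof. destruct (wo_ax X) as [_ [H _]]. apply H. Qed.
Lemma lt_tri x y : x << y \/ x = y \/ y << x.
Proof. destruct (wo_ax X) as [_ [_ [H _]]]. apply H. Qed.
Lemma lt_wf : well_founded (@lt X).
Proof. destruct (wo_ax X) as [_ [_ [_ H]]]. exact H. Qed.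
Lemma ltW x y : x << y -> x <<= y.
Proof. intros H H'. exact (lt_irr _ (lt_tr _ _ _ H H')). Qed.
Lemma le_refl x : x <<= x.
Proof. apply lt_irr. Qed.
Lemma lt_or_le x y : x << y \/ y <<= x.
Proof. apply classic. Qed.
Lemma le_lt_or_eq x y : x <<= y -> x << y \/ x = y.
Proof. intros H. destruct (lt_tri x y) as [h|[h|h]]; auto. contradiction. Qed.
Lemma le_lt x y z : x <<= y -> y << z -> x << z.
Proof. intros H. destruct (le_lt_or_eq _ _ H) as [h|<-]; auto. apply lt_tr; auto. Qed.
Lemma lt_le x y z : x << y -> y <<= z -> x << z.
Proof. intros H H'. destruct (le_lt_or_eq _ _ H') as [h|<-]; auto. eapply lt_tr; eauto. Qed.
Lemma le_tr x y z : x <<= y -> y <<= z -> x <<= z.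
Proof. intros H H' H2. exact (H' (lt_le _ _ _ H2 H)). Qed.
Lemma le_anti x y : x <<= y -> y <<= x -> x = y.
Proof. intros H H'. destruct (le_lt_or_eq _ _ H); auto. contradiction. Qed.
Lemma neq_lt x y : x <> y -> x << y \/ y << x.
Proof. intros H. destruct (lt_tri x y) as [h|[h|h]]; auto. contradiction. Qed.

Lemma wf_min (P : X -> Prop) : (exists x, P x) -> exists x, P x /\ forall y, P y -> x <<= y.
Proof.
  intros [x hx]. apply NNPP. intros Hn.
  revert hx. induction x as [x IH] using (well_founded_ind lt_wf). intros hx.
  apply Hn. exists x. split; auto. intros y hy hyx. exact (IH y hyx hy).
Qed.

Lemma max2 x y : exists z, x <<= z /\ y <<= z.
Proof.
  destruct (lt_or_le x y) as [h|h].
  - exists y. split; [apply ltW; auto | apply le_refl].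
  - exists x. split; [apply le_refl | auto].
Qed.

Lemma lub_exists (P : X -> Prop) b : (forall x, P x -> x <<= b) ->
  exists s, s <<= b /\ (forall x, P x -> x <<= s) /\ (forall y, y << s -> exists x, P x /\ y << x).
Proof.
  intros H. destruct (wf_min (fun s => forall x, P x -> x <<= s)) as [s [h1 h2]].
  { exists b; auto. }
  exists s. split; [apply h2; auto | split; auto].
  intros y hy. apply NNPP. intros hn. apply (h2 y); auto.
  intros x px hyx. apply hn. exists x; auto.
Qed.
End Order.

(** Transfinite recursion with a choice at every stage. The first premise makes [R a g b] depend on
    [g] only below [a]; a legal value has to exist only when all earlier values are legal. *)
Lemma wf_rec_choice (X : WO) (B : Type) (R : X -> (X -> B) -> B -> Prop) :
  inhabited B ->
  (forall a g g' b, (forall x, x << a -> g x = g' x) -> R a g b -> R a g' b) ->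
  (forall a g, (forall x, x << a -> R x g (g x)) -> exists b, R a g b) ->
  exists F : X -> B, forall a, R a F (F a).
Proof.
  intros [d] Hext Hex.
  (* [cut] turns the partial function known below [a] into a total one, with the default [d]
     elsewhere, so that [R a] can be applied to it. *)
  pose (cut := fun (a : X) (r : forall y, y << a -> B) (x : X) =>
    match excluded_middle_informative (x << a) with left h => r x h | right _ => d end).
  pose (step := fun (a : X) (r : forall y, y << a -> B) =>
    epsilon (inhabits d) (R a (cut a r))).
  pose (F := Fix lt_wf (fun _ => B) step).
  assert (HF : forall a, F a = epsilon (inhabits d) (R a (cut a (fun y _ => F y)))).
  { intros a. unfold F. rewrite Fix_eq; [reflexivity|].
    intros x f g h. unfold step. f_equal. f_equal. f_equal.
    apply functional_extensionality_dep. intros y.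
    apply functional_extensionality_dep. intros q. apply h. }
  exists F. intros a. induction a as [a IH] using (well_founded_ind lt_wf).
  assert (hc : forall x, x << a -> F x = cut a (fun y _ => F y) x).
  { intros x hx. unfold cut. destruct (excluded_middle_informative (x << a)); [auto|contradiction]. }
  destruct (Hex a F IH) as [b hb].
  apply (Hext a (cut a (fun y _ => F y))).
  { intros x hx. symmetry. auto. }
  rewrite (HF a). apply epsilon_spec. exists b. eapply Hext; [exact hc|exact hb].
Qed.

(** * Cardinal comparison of subsets *)

(* The witnessing relation need not be functional: a total relation that is
   injective from right to left contains an injection. *)
Definition cle {X Y : Type} (A : X -> Prop) (B : Y -> Prop) : Prop :=
  exists R : X -> Y -> Prop, (forall x, A x -> exists y, B y /\ R x y) /\
    (forall x x' y, A x -> A x' -> B y -> R x y -> R x' y -> x = x').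

Definition prodS {X Y : Type} (A : X -> Prop) (B : Y -> Prop) : X * Y -> Prop :=
  fun q => A (fst q) /\ B (snd q).

Definition inf {X : Type} (A : X -> Prop) : Prop := cle (full nat) A.
Definition fin {X : Type} (A : X -> Prop) : Prop := exists n, cle A (fun k : nat => k < n).

Lemma cle_sub {X : Type} (A B : X -> Prop) : (forall x, A x -> B x) -> cle A B.
Proof. intros H. exists eq. split; [eauto | intros; congruence]. Qed.

Lemma cle_refl {X : Type} (A : X -> Prop) : cle A A.
Proof. apply cle_sub; auto. Qed.

Lemma cle_fun_intro {X Y : Type} (A : X -> Prop) (B : Y -> Prop) (f : X -> Y) :
  (forall x, A x -> B (f x)) -> (forall x x', A x -> A x' -> f x = f x' -> x = x') -> cle A B.
Proof. intros H1 H2. exists (fun x y => f x = y). split; [eauto|]. intros; subst; auto. Qed.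

Lemma cle_trans {X Y Z : Type} (A : X -> Prop) (B : Y -> Prop) (D : Z -> Prop) :
  cle A B -> cle B D -> cle A D.
Proof.
  intros [R [h1 h2]] [S [k1 k2]].
  exists (fun x z => exists y, B y /\ R x y /\ S y z). split.
  - intros x ax. destruct (h1 x ax) as [y [hy r]]. destruct (k1 y hy) as [z [hz s]]. eauto 8.
  - intros x x' z ax ax' dz [y [b [r s]]] [y' [b' [r' s']]].
    assert (y = y') by (eapply k2; eauto). subst. eauto.
Qed.

Lemma cle_prod {X Y X' Y' : Type} (A : X -> Prop) (B : Y -> Prop) (A' : X' -> Prop) (B' : Y' -> Prop) :
  cle A A' -> cle B B' -> cle (prodS A B) (prodS A' B').
Proof.
  intros [R [h1 h2]] [S [k1 k2]].
  exists (fun q q' => R (fst q) (fst q') /\ S (snd q) (snd q')). split.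
  - intros [x y] [ax ay]. destruct (h1 x ax) as [x' [? ?]]. destruct (k1 y ay) as [y' [? ?]].
    exists (x', y'). unfold prodS; simpl; auto.
  - intros [x y] [x1 y1] [x' y'] [? ?] [? ?] [? ?] [? ?] [? ?]. simpl in *.
    f_equal; eauto.
Qed.

Lemma cle_fun {X Y : Type} (A : X -> Prop) (B : Y -> Prop) : inhabited Y -> cle A B ->
  exists f : X -> Y, (forall x, A x -> B (f x)) /\ (forall x x', A x -> A x' -> f x = f x' -> x = x').
Proof.
  intros hY [R [h1 h2]]. destruct (fun_choice_on A (fun x y => B y /\ R x y) hY h1) as [f hf].
  exists f. split; [intros; apply hf; auto|].
  intros x x' ax ax' e. destruct (hf x ax) as [b r]. destruct (hf x' ax') as [b' r'].
  rewrite e in *. eauto.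
Qed.

(** A union of [|J|] sets of size at most [|D|]. The members may overlap: an element may be related
    to several pairs, so no index has to be chosen for it. *)
Lemma cle_family {X I N : Type} (A : X -> Prop) (J : I -> Prop) (B : I -> X -> Prop) (D : N -> Prop) :
  (forall a, A a -> exists i, J i /\ B i a) -> (forall i, J i -> cle (B i) D) ->
  cle A (prodS J D).
Proof.
  intros HA HB. destruct (fun_choice_on J (fun i R =>
    (forall x, B i x -> exists y, D y /\ R x y) /\
    (forall x x' y, B i x -> B i x' -> D y -> R x y -> R x' y -> x = x'))
    (inhabits (fun (_ : X) (_ : N) => True)) HB) as [R HR].
  exists (fun a q => B (fst q) a /\ R (fst q) a (snd q)). split.
  - intros a ha. destruct (HA a ha) as [i [ji bi]]. destruct (HR i ji) as [h _].
    destruct (h a bi) as [y [? ?]]. exists (i, y). unfold prodS; simpl; auto.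
  - intros a a' [i y] _ _ [ji dy] [b r] [b' r']. simpl in *.
    destruct (HR i ji) as [_ h]. eapply h; eauto.
Qed.

(** Hilbert's hotel: [q] goes to [e 0], every other [e n] moves to [e (S n)], and the remaining
    elements stay fixed. This also covers the case that [q] lies in [A] already. *)
Lemma cle_add1 {X : Type} (A : X -> Prop) (q : X) : inf A -> cle (fun x => A x \/ x = q) A.
Proof.
  intros Hi. destruct (cle_fun _ _ (inhabits q) Hi) as [e [e1 e2]].
  assert (e1' : forall n, A (e n)) by (intros; apply e1; exact I).
  assert (e2' : forall n k, e n = e k -> n = k) by (intros; apply e2; auto; exact I).
  exists (fun x y => (x = q /\ y = e 0) \/ (x <> q /\ exists n, x = e n /\ y = e (S n)) \/
                     (x <> q /\ (~ exists n, x = e n) /\ y = x)). split.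
  - intros x hx. destruct (classic (x = q)) as [->|hq]; [exists (e 0); auto|].
    destruct hx as [hx|hx]; [|contradiction].
    destruct (classic (exists n, x = e n)) as [[n hn]|hn].
    + exists (e (S n)). split; auto. right; left. eauto.
    + exists x. split; auto.
  - intros x x' y _ _ _ H H'.
    destruct H as [[hx hy]|[[hx [k [hk hy]]]|[hx [hk hy]]]];
    destruct H' as [[hx' hy']|[[hx' [l [hl hy']]]|[hx' [hl hy']]]]; subst;
      try reflexivity; try (exfalso; eauto; fail);
      match goal with E : e _ = e _ |- _ => apply e2' in E; congruence end.
Qed.

Lemma inf_mono {X Y : Type} (A : X -> Prop) (B : Y -> Prop) : inf A -> cle A B -> inf B.
Proof. apply cle_trans. Qed.

Lemma fin_not_inf {X : Type} (A : X -> Prop) : fin A -> inf A -> False.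
Proof.
  intros [n Hn] Hi. pose proof (cle_trans _ _ _ Hi Hn) as H.
  destruct (cle_fun _ _ (inhabits 0) H) as [e [e1 e2]].
  assert (Hnd : NoDup (map e (seq 0 (S n)))).
  { apply NoDup_map_NoDup_ForallPairs; [|apply seq_NoDup].
    intros a b _ _ h. apply e2; auto; exact I. }
  assert (Hin : incl (map e (seq 0 (S n))) (seq 0 n)).
  { intros y hy. apply in_map_iff in hy. destruct hy as [x [<- _]].
    apply in_seq. specialize (e1 x I). simpl in e1. lia. }
  pose proof (NoDup_incl_length Hnd Hin) as h. rewrite length_map, !length_seq in h. lia.
Qed.

Lemma fin_prod {X Y : Type} (A : X -> Prop) (B : Y -> Prop) : fin A -> fin B -> fin (prodS A B).
Proof.
  intros [n Hn] [k Hk]. exists (n * k). eapply cle_trans; [eapply cle_prod; eauto|].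
  apply (cle_fun_intro _ _ (fun q => fst q * k + snd q)).
  - intros [x y] [h1 h2]. simpl in *. nia.
  - intros [x y] [x' y'] [h1 h2] [h3 h4] e. simpl in *.
    assert (x = x') by nia. subst. f_equal. lia.
Qed.

Lemma fin_add1 {X : Type} (A : X -> Prop) (q : X) : fin A -> fin (fun x => A x \/ x = q).
Proof.
  intros [n [R [h1 h2]]]. exists (S n).
  exists (fun x k => (x = q /\ k = n) \/ (A x /\ k < n /\ R x k)). split.
  - intros x [ax|e]; [|exists n; split; auto].
    destruct (h1 x ax) as [y [? ?]]. exists y. split; auto.
  - intros x x' y _ _ _ [[e h]|[a [b c]]] [[e' h']|[a' [b' c']]]; try congruence; try lia. eauto.
Qed.

Lemma compare (X Y : WO) (A : X -> Prop) (B : Y -> Prop) :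
  cle A B \/ exists a, A a /\ cle B (fun x => A x /\ x << a).
Proof.
  destruct (classic (exists a, A a)) as [[a0 ha0]|hn].
  2:{ left. exists (fun _ _ => True). split; [intros x ax|intros x x' y ax]; exfalso; eauto. }
  destruct (classic (inhabited Y)) as [hY|hn].
  2:{ right. exists a0. split; auto. exists (fun _ _ => True).
      split; intros y; exfalso; apply hn; constructor; auto. }
  set (fresh := fun a (g : X -> Y) y => B y /\ forall x, x << a -> A x -> g x <> y).
  destruct (wf_rec_choice X Y (fun a g b => (exists y, fresh a g y) -> fresh a g b) hY) as [F HF].
  - intros a g g' b hg H [y [hy hy']]. destruct H as [h1 h2].
    + exists y. split; auto. intros x hx ax. rewrite hg; auto.
    + split; auto. intros x hx ax. rewrite <- hg; auto.
  - intros a g _. destruct (classic (exists y, fresh a g y)) as [[y hy]|hn].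
    + exists y; auto.
    + destruct hY as [y]. exists y. tauto.
  - destruct (classic (forall a, A a -> exists y, fresh a F y)) as [Hall|Hno].
    + left. apply (cle_fun_intro _ _ F).
      * intros x ax. apply (HF x (Hall x ax)).
      * intros x x' ax ax' e. apply NNPP. intros hne.
        destruct (neq_lt _ _ hne) as [h|h].
        -- destruct (HF x' (Hall x' ax')) as [_ h']. exact (h' x h ax e).
        -- destruct (HF x (Hall x ax)) as [_ h']. exact (h' x' h ax' (eq_sym e)).
    + right. apply not_all_ex_not in Hno. destruct Hno as [a Ha].
      apply imply_to_and in Ha. destruct Ha as [ha hf]. exists a. split; auto.
      exists (fun y x => F x = y). split.
      * intros y hy. apply NNPP. intros hn. apply hf. exists y. split; auto.
        intros x hx ax e. apply hn. exists x. auto.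
      * intros; congruence.
Qed.

Lemma nat_is_wo : is_wo Nat.lt.
Proof. split; [|split; [|split]]; try (intros; lia). exact Wf_nat.lt_wf. Qed.

Definition natWO : WO := MkWO nat Nat.lt nat_is_wo.

Lemma fin_or_inf (X : WO) (A : X -> Prop) : fin A \/ inf A.
Proof.
  destruct (compare natWO X (full nat) A) as [h|[n [_ h]]]; [right; exact h|left].
  exists n. eapply cle_trans; [exact h|]. apply cle_sub. intros x [_ hx]. exact hx.
Qed.

(** * Squares of infinite cardinals *)

Section Goedel.
Variable X : WO.

Definition maxX (x y : X) : X := if excluded_middle_informative (x << y) then y else x.
Lemma maxX_ge (x y : X) : x <<= maxX x y /\ y <<= maxX x y.
Proof.
  unfold maxX. destruct (excluded_middle_informative (x << y)).
  - split; [apply ltW; auto|apply le_refl].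
  - split; [apply le_refl|auto].
Qed.
Lemma maxX_or (x y : X) : maxX x y = x \/ maxX x y = y.
Proof. unfold maxX. destruct (excluded_middle_informative (x << y)); auto. Qed.

(** Goedel's well-order of pairs: by the maximum first, then lexicographically. The predecessors of
    a pair thus lie in the square of an initial segment. *)
Definition ltG (q r : X * X) : Prop :=
  maxX (fst q) (snd q) << maxX (fst r) (snd r) \/
  (maxX (fst q) (snd q) = maxX (fst r) (snd r) /\
   (fst q << fst r \/ (fst q = fst r /\ snd q << snd r))).

Lemma ltG_wo : is_wo ltG.
Proof.
  assert (I := @lt_irr X). assert (T := @lt_tr X).
  split; [|split; [|split]].
  - intros [x y] [h|[_ [h|[_ h]]]]; eapply I; eauto.
  - intros [q1 q2] [r1 r2] [s1 s2]. unfold ltG; simpl.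
    generalize (maxX q1 q2) (maxX r1 r2) (maxX s1 s2). intros a b c.
    intros [h|[e [h|[e' h]]]] [k|[f [k|[f' k]]]]; subst; auto;
      try (pose proof (T _ _ _ h k)); auto 7.
  - intros [x y] [x' y']. unfold ltG; simpl.
    destruct (lt_tri (maxX x y) (maxX x' y')) as [h|[h|h]]; auto.
    pose proof (eq_sym h).
    destruct (lt_tri x x') as [k|[k|k]]; auto 8.
    destruct (lt_tri y y') as [l|[l|l]]; subst; auto 9.
  - assert (W : forall m x y, maxX x y = m -> Acc ltG (x, y)).
    { intros m. induction m as [m IHm] using (well_founded_ind (@lt_wf X)).
      intros x. induction x as [x IHx] using (well_founded_ind (@lt_wf X)).
      intros y. induction y as [y IHy] using (well_founded_ind (@lt_wf X)).
      intros e. constructor. intros [x' y'] [h|[h [k|[k l]]]]; simpl in *.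
      - eapply IHm; [|reflexivity]. congruence.
      - eapply IHx; eauto. congruence.
      - subst x'. eapply IHy; eauto. congruence. }
    intros [x y]. eapply W; reflexivity.
Qed.

(** If the square were larger, [A] would embed into the Goedel predecessors of some pair, hence into
    the square of a closed initial segment [B] with top [y] in [A]. That square is finite or no
    larger than [seg y], and [A] is larger than both. *)
Lemma square_step (A : X -> Prop) :
  (forall x y, A y -> x << y -> A x) -> inf A ->
  (forall y, A y -> ~ cle A (seg y)) ->
  (forall y, A y -> inf (seg y) -> cle (prodS (seg y) (seg y)) (seg y)) ->
  cle (prodS A A) A.
Proof.
  intros Hd Hi Hc IH.
  destruct (compare (MkWO (X * X) ltG ltG_wo) X (prodS A A) A) as [h|[[a b] [[ha hb] h]]]; auto.
  exfalso. simpl in *. set (y := maxX a b).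
  assert (hy : A y) by (unfold y; destruct (maxX_or a b) as [-> | ->]; auto).
  set (B := fun x => seg y x \/ x = y).
  assert (hAB : cle A (prodS B B)).
  { eapply cle_trans; [exact h|]. apply cle_sub. intros [u v] [_ huv].
    assert (hm : maxX u v <<= y).
    { destruct huv as [k|[k _]]; simpl in k; [apply ltW; exact k|].
      unfold y. rewrite k. apply le_refl. }
    destruct (maxX_ge u v) as [k1 k2].
    split; simpl; apply le_lt_or_eq; eapply le_tr; eauto. }
  destruct (fin_or_inf X (seg y)) as [hf|hi].
  - apply (fin_not_inf (prodS B B)).
    + apply fin_prod; apply fin_add1; auto.
    + eapply inf_mono; eauto.
  - apply (Hc y hy). eapply cle_trans; [exact hAB|].
    eapply cle_trans; [|apply IH; eauto].
    apply cle_prod; apply cle_add1; exact hi.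
Qed.

Lemma square_seg (y : X) : inf (seg y) -> cle (prodS (seg y) (seg y)) (seg y).
Proof.
  induction y as [y IH] using (well_founded_ind (@lt_wf X)). intros hi.
  destruct (classic (exists x, x << y /\ cle (seg y) (seg x))) as [[x [hx hc]]|hn].
  - apply (cle_trans _ (prodS (seg x) (seg x))); [apply cle_prod; exact hc|].
    eapply cle_trans; [apply IH; auto; eapply inf_mono; eauto|].
    apply cle_sub. intros z hz. eapply lt_tr; eauto.
  - apply square_step; auto.
    + intros a b hb ha. eapply lt_tr; eauto.
    + intros x hx hc. apply hn. eauto.
Qed.

Lemma square_full : inf (full X) -> (forall y : X, ~ cle (full X) (seg y)) ->
  cle (prodS (full X) (full X)) (full X).
Proof.
  intros hi hc. apply square_step; auto. intros; apply square_seg; auto.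
Qed.
End Goedel.

(** * Injections between types versus [cle], and further cardinal arithmetic *)

Lemma inj_cle_sig {A B : Type} (P : A -> Prop) (Q : B -> Prop) :
  inj {x | P x} {y | Q y} -> cle P Q.
Proof.
  intros [f hf]. exists (fun x y => exists h : P x, proj1_sig (f (exist _ x h)) = y). split.
  - intros x h. exists (proj1_sig (f (exist _ x h))). split; [apply proj2_sig|eauto].
  - intros x x' y _ _ _ [h <-] [h' e].
    assert (e' : f (exist _ x h) = f (exist _ x' h')).
    { destruct (f (exist _ x h)) as [u hu], (f (exist _ x' h')) as [v hv]. simpl in e. subst v.
      f_equal. apply proof_irrelevance. }
    apply hf in e'. congruence.
Qed.

Lemma cle_inj {A B : Type} : cle (full A) (full B) -> inj A B.
Proof.
  intros [R [h1 h2]]. destruct (fun_choice _ (fun x => h1 x I)) as [f hf].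
  exists f. intros x y e. destruct (hf x), (hf y). rewrite <- e in *. eapply h2; eauto; exact I.
Qed.

Lemma cle_inj_sigr {A B : Type} (Q : B -> Prop) : cle (full A) Q -> inj A {y | Q y}.
Proof.
  intros h. apply cle_inj. eapply cle_trans; [exact h|].
  exists (fun y z => proj1_sig z = y). split.
  - intros y hy. exists (exist _ y hy). split; [exact I|reflexivity].
  - intros; congruence.
Qed.

Lemma inj_cle_sigl {A B : Type} (P : A -> Prop) : inj {x | P x} B -> cle P (full B).
Proof.
  intros [f hf]. exists (fun x y => exists h : P x, f (exist _ x h) = y). split.
  - intros x h. exists (f (exist _ x h)). split; [exact I|eauto].
  - intros x x' y _ _ _ [h e] [h' e']. rewrite <- e' in e. apply hf in e. congruence.
Qed.

Lemma inj_cle {A B : Type} : inj A B -> cle (full A) (full B).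
Proof. intros [f hf]. apply (cle_fun_intro _ _ f); intros; [exact I|auto]. Qed.

Lemma cle_image {T Y : Type} (A : T -> Prop) (u : T -> Y) :
  cle (fun y => exists x, A x /\ y = u x) A.
Proof. exists (fun y x => y = u x). split; [eauto|intros; congruence]. Qed.

Lemma cle_fin_inf {X Y : Type} (A : X -> Prop) (B : Y -> Prop) : fin A -> inf B -> cle A B.
Proof.
  intros [n h] hB. eapply cle_trans; [exact h|]. eapply cle_trans; [|exact hB].
  apply (cle_fun_intro _ _ (fun k => k)); [intros; exact I|auto].
Qed.

Lemma cle_add1_gen {X : WO} {Y : Type} (A : X -> Prop) (B : Y -> Prop) (q : X) :
  cle A B -> inf B -> cle (fun x => A x \/ x = q) B.
Proof.
  intros h hB. destruct (fin_or_inf X A) as [hf|hi].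
  - apply cle_fin_inf; auto. apply fin_add1; auto.
  - eapply cle_trans; [apply cle_add1; exact hi|exact h].
Qed.

Lemma seg_mono {X : WO} (x y : X) : x <<= y -> cle (seg x) (seg y).
Proof. intros h. apply cle_sub. intros z hz. eapply lt_le; eauto. Qed.

Lemma increasing_nat {X : WO} (e : nat -> X) : (forall n, e n << e (S n)) ->
  forall n k, n < k -> e n << e k.
Proof.
  intros H n k h. induction h; auto. eapply lt_tr; eauto.
Qed.

Lemma nomax_inf (X : WO) : inhabited X -> (forall x : X, exists y, x << y) -> inf (full X).
Proof.
  intros [x0] H. destruct (fun_choice _ H) as [s hs].
  set (e := fix e n := match n with 0 => x0 | S n => s (e n) end).
  assert (he := increasing_nat e (fun n => hs (e n))).
  apply (cle_fun_intro _ _ e); [intros; exact I|].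
  intros n k _ _ h. destruct (Nat.lt_trichotomy n k) as [l|[l|l]]; auto;
    apply he in l; rewrite h in l; destruct (lt_irr _ l).
Qed.

Definition limpt {X : WO} (E : X -> Prop) (x : X) : Prop :=
  forall y, y << x -> exists e, E e /\ y << e /\ e << x.

(** Send a limit point to the least element of [B] above or equal to it. Between two limit points
    there is an element of [B], so different limit points get different images. *)
Lemma cle_limpt {X : WO} (B : X -> Prop) (d : X) : (forall y, y << d -> exists x, B x /\ y << x) ->
  cle (fun g => g << d /\ limpt B g) B.
Proof.
  intros hB. exists (fun g b => B b /\ g <<= b /\ forall b', B b' -> g <<= b' -> b <<= b'). split.
  - intros g [hg _]. destruct (wf_min (fun b => B b /\ g <<= b)) as [b [[h1 h2] h3]].
    + destruct (hB g hg) as [x [hx h]]. exists x. split; auto. apply ltW; auto.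
    + exists b. auto 7.
  - assert (H : forall g g' b, limpt B g' -> g' <<= b -> g << g' ->
      ~ (forall b', B b' -> g <<= b' -> b <<= b')).
    { intros g g' b hl h h' hb. destruct (hl g h') as [e [he [h1 h2]]].
      apply (hb e he (ltW _ _ h1)). eapply lt_le; eauto. }
    intros g g' b [_ l] [_ l'] _ [_ [h1 h2]] [_ [h3 h4]]. apply NNPP. intros hn.
    destruct (neq_lt _ _ hn) as [h|h]; [eapply (H g g')|eapply (H g' g)]; eauto.
Qed.

Lemma cle_union {X Y : Type} (A B : X -> Prop) (D : Y -> Prop) :
  inf D -> cle (prodS D D) D -> cle A D -> cle B D -> cle (fun x => A x \/ B x) D.
Proof.
  intros hi hs hA hB.
  eapply cle_trans; [apply (cle_family _ (full bool) (fun b : bool => if b then A else B) D)|].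
  - intros a [h|h]; [exists true|exists false]; split; auto; exact I.
  - intros [] _; auto.
  - eapply cle_trans; [|exact hs]. apply cle_prod; [|apply cle_refl].
    apply cle_fin_inf; auto. exists 2.
    apply (cle_fun_intro _ _ (fun b : bool => if b then 1 else 0)).
    + intros [] _; lia.
    + intros [] [] _ _; auto; discriminate.
Qed.

(** * A singular cardinal [M], its cofinality [C] and its successor [K] *)

Section Singular.
Context (M C K : WO).
Hypothesis M_init : forall x : M, ~ cle (full M) (seg x).
Hypothesis M_inf : inf (full M).
Context (cofM : C -> M).
Hypothesis cofM_cofinal : forall x, exists d, x << cofM d.
Hypothesis C_init : forall c : C, ~ cle (full C) (seg c).
Hypothesis C_min : forall (D : Type) (h : D -> M),
  (forall x, exists d, x << h d) -> cle (full C) (full D).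
Hypothesis M_sing : ~ cle (full M) (full C).
Hypothesis K_seg : forall x : K, cle (seg x) (full M).
Hypothesis K_big : ~ cle (full K) (full M).

Lemma M_inh : inhabited M.
Proof. destruct M_inf as [R [h _]]. destruct (h 0 I) as [y _]. constructor; exact y. Qed.

Lemma C_inh : inhabited C.
Proof. destruct M_inh as [x]. destruct (cofM_cofinal x) as [d _]. constructor; exact d. Qed.

Lemma K_inh : inhabited K.
Proof.
  apply NNPP. intros hn. apply K_big. exists (fun _ _ => True).
  split; intros x; destruct hn; constructor; exact x.
Qed.

Lemma M_nomax (m : M) : exists m', m << m'.
Proof. destruct (cofM_cofinal m) as [d h]. eauto. Qed.

(** An unbounded [u] would be a cofinal map from a set smaller than [C], against the minimality of
    the cofinality. *)
Lemma small_bounded_M {T : Type} (A : T -> Prop) (u : T -> M) (xi : C) :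
  cle A (seg xi) -> exists m, forall x, A x -> u x << m.
Proof.
  intros hA. apply NNPP. intros hn. apply (C_init xi).
  eapply cle_trans; [|exact hA]. eapply cle_trans.
  - apply (C_min {x | A x} (fun x => u (proj1_sig x))). intros m.
    destruct (M_nomax m) as [m' hm]. apply NNPP. intros hn'. apply hn. exists m'.
    intros x hx. apply NNPP. intros hh. apply hn'. exists (exist _ x hx). simpl.
    eapply lt_le; eauto.
  - apply (cle_fun_intro _ _ (@proj1_sig _ A)); [intros [x hx] _; exact hx|].
    intros [x hx] [y hy] _ _. simpl. intros ->. f_equal. apply proof_irrelevance.
Qed.

Lemma initial_bounded_M (u : C -> M) (c : C) : exists m, forall d, d <<= c -> u d << m.
Proof.
  destruct (small_bounded_M (seg c) u c (cle_refl _)) as [m hm].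
  destruct (max2 m (u c)) as [m' [h1 h2]]. destruct (M_nomax m') as [m'' h3].
  exists m''. intros d hd. destruct (le_lt_or_eq _ _ hd) as [h| ->].
  - eapply lt_tr; [apply hm; auto|]. eapply le_lt; eauto.
  - eapply le_lt; eauto.
Qed.

Lemma C_nomax (c : C) : exists c', c << c'.
Proof.
  apply NNPP. intros hn. destruct (initial_bounded_M cofM c) as [m hm].
  destruct (cofM_cofinal m) as [d hd]. apply (lt_irr m).
  eapply lt_tr; [exact hd|]. apply hm. intros h. eauto.
Qed.

(** Regularity of the cofinality: if [b c] bounds [cofM] up to [c], then an unbounded [u] would make
    [b (u x)] unbounded in [M]. *)
Lemma small_bounded_C {T : Type} (A : T -> Prop) (u : T -> C) (xi : C) :
  cle A (seg xi) -> exists c, forall x, A x -> u x << c.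
Proof.
  intros hA. apply NNPP. intros hn.
  destruct (fun_choice _ (initial_bounded_M cofM)) as [b hb].
  destruct (small_bounded_M A (fun x => b (u x)) xi hA) as [m hm].
  destruct (cofM_cofinal m) as [d hd]. apply hn. exists d. intros x hx.
  destruct (lt_or_le (u x) d) as [h|h]; auto. exfalso. apply (lt_irr m).
  eapply lt_tr; [exact hd|]. eapply lt_tr; [apply hb; exact h|]. apply hm; auto.
Qed.

Lemma C_inf : inf (full C).
Proof. apply nomax_inf; [apply C_inh|apply C_nomax]. Qed.

Lemma C_small : exists m : M, cle (full C) (seg m).
Proof.
  destruct (compare M C (full M) (full C)) as [h|[a [_ h]]]; [contradiction|].
  exists a. eapply cle_trans; [exact h|]. apply cle_sub. intros x [_ hx]. exact hx.
Qed.

Lemma base_exists : exists m : M, cle (full C) (seg m) /\ inf (seg m).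
Proof. destruct C_small as [m h]. exists m. split; auto. eapply inf_mono; [apply C_inf|exact h]. Qed.

(** * Successor cardinals below [M], and regularity of [K] *)

Lemma M_square : cle (prodS (full M) (full M)) (full M).
Proof. apply square_full; auto. Qed.

(** For a nonzero limit [t] this says [cf t > |m|]. Since the bound [y] need not be strict, a [t]
    with an immediate predecessor satisfies it too. *)
Definition bounding (m t : M) : Prop :=
  forall V : M -> Prop, cle V (seg m) -> (forall v, V v -> v << t) ->
    exists y, y << t /\ forall v, V v -> v <<= y.

(** The cardinal successor of [|m|] as an ordinal in [M], with its regularity built in. *)
Definition succ_card (m t : M) : Prop :=
  bounding m t /\ ~ cle (seg t) (seg m) /\ (forall y, y << t -> cle (seg y) (seg m)) /\
  (forall y, y << t -> exists y', y' << t /\ y << y').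

(** [t] is the least ordinal not embeddable into [m]. If there were none, [M] would be a union of
    [|C|] sets of size at most [|m|], hence too small. Regularity holds because a small unbounded
    [V] would cover [t] by [|m|] sets of size at most [|m|]. *)
Lemma succ_exists (m : M) : inf (seg m) -> exists t, succ_card m t.
Proof.
  intros hm. destruct (wf_min (fun t : M => ~ cle (seg t) (seg m))) as [t [ht tmin]].
  { apply NNPP. intros hn.
    assert (hall : forall t : M, cle (seg t) (seg m)).
    { intros t. apply NNPP. intros h. eauto. }
    destruct C_small as [m0 h0]. destruct (max2 m m0) as [x [hx1 hx2]].
    apply (M_init x).
    eapply cle_trans; [apply (cle_family _ (full C) (fun c => seg (cofM c)) (seg m))|].
    - intros a _. destruct (cofM_cofinal a) as [d hd]. exists d. split; [exact I|exact hd].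
    - auto.
    - eapply cle_trans; [|apply square_seg; eapply inf_mono; [exact hm|apply seg_mono; exact hx1]].
      apply cle_prod; [eapply cle_trans; [exact h0|]|]; apply seg_mono; auto. }
  assert (hy : forall y, y << t -> cle (seg y) (seg m)).
  { intros y hy. apply NNPP. intros h. exact (tmin y h hy). }
  assert (hy1 : forall y, y << t -> cle (fun x => x <<= y) (seg m)).
  { intros y h. eapply cle_trans; [|apply (cle_add1_gen (seg y) (seg m) y); auto].
    apply cle_sub. intros x. apply le_lt_or_eq. }
  exists t. split; [|split; [auto|split; auto]].
  - intros V hV hVt. apply NNPP. intros hn. apply ht.
    eapply cle_trans; [apply (cle_family _ V (fun v x => x <<= v) (seg m))|].
    + intros x hx. apply NNPP. intros hn'. apply hn. exists x. split; auto.
      intros v hv h. apply hn'. exists v. split; auto. apply ltW; auto.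
    + intros v hv. apply hy1; auto.
    + eapply cle_trans; [|apply square_seg; auto]. apply cle_prod; [exact hV|apply cle_refl].
  - intros y h. apply NNPP. intros hn. apply ht. eapply cle_trans; [|apply (hy1 y h)].
    apply cle_sub. intros x hx h'. apply hn. eauto.
Qed.

Lemma bounding_fam (m t : M) {T : Type} (A : T -> Prop) (u : T -> M) :
  succ_card m t -> cle A (seg m) -> (forall x, A x -> u x << t) ->
  exists y, y << t /\ forall x, A x -> u x << y.
Proof.
  intros [hb [_ [_ hs]]] hA hu.
  destruct (hb (fun y => exists x, A x /\ y = u x)) as [y [h1 h2]].
  - eapply cle_trans; [apply cle_image|exact hA].
  - intros v [x [ax ->]]. auto.
  - destruct (hs y h1) as [y' [h3 h4]]. exists y'. split; auto.
    intros x ax. eapply le_lt; [apply h2; eauto|auto].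
Qed.

Lemma succ_gt (m t : M) : succ_card m t -> m << t.
Proof.
  intros [_ [h _]]. destruct (lt_or_le m t) as [h'|h']; auto.
  exfalso. apply h. apply seg_mono; auto.
Qed.

Lemma succ_inf (m t : M) : inf (seg m) -> succ_card m t -> inf (seg t).
Proof. intros h h'. eapply inf_mono; [exact h|apply seg_mono, ltW, succ_gt; auto]. Qed.

(** Regularity of the successor cardinal: an unbounded family would cover [K] by [|M|] closed
    initial segments, each of size at most [|M|]. *)
Lemma bounded_K {T : Type} (A : T -> Prop) (u : T -> K) :
  cle A (full M) -> exists k, forall x, A x -> u x << k.
Proof.
  intros hA. apply NNPP. intros hn. apply K_big.
  eapply cle_trans; [apply (cle_family _ A (fun x k => k <<= u x) (full M))|].
  - intros k _. apply NNPP. intros hn'. apply hn. exists k. intros x ax.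
    apply NNPP. intros h. apply hn'. exists x. split; auto.
  - intros x _. eapply cle_trans; [|apply (cle_add1_gen (seg (u x)) (full M) (u x)); auto].
    apply cle_sub. intros y. apply le_lt_or_eq.
  - eapply cle_trans; [|apply M_square]. apply cle_prod; [exact hA|apply cle_refl].
Qed.

Lemma cle_single {T : Type} (x : T) : cle (eq x) (full M).
Proof.
  destruct M_inh as [y]. exists (fun _ _ => True). split; [intros; exists y; split; exact I|].
  intros; congruence.
Qed.

Lemma K_nomax (k : K) : exists k', k << k'.
Proof. destruct (bounded_K (eq k) (fun x => x) (cle_single k)) as [k' h]. eauto. Qed.

(** * Club guessing below a cardinal of M *)

(* The least element of [M] is vacuously a limit point, so every club contains it. *)
Definition club (t : M) (E : M -> Prop) : Prop :=
  (forall x, E x -> x << t) /\ (forall x, x << t -> exists e, E e /\ x << e) /\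
  (forall x, x << t -> limpt E x -> E x).

Lemma club_ext (t : M) (E E' : M -> Prop) : (forall z, E z <-> E' z) -> club t E -> club t E'.
Proof.
  intros h [h1 [h2 h3]]. split; [|split].
  - intros x hx. apply h1, h; auto.
  - intros x hx. destruct (h2 x hx) as [e [he hh]]. exists e. split; auto. apply h; auto.
  - intros x hx hl. apply h, h3; auto. intros y hy. destruct (hl y hy) as [e [he hh]].
    exists e. split; auto. apply h; auto.
Qed.

Lemma succ_above2 (n t x y : M) : succ_card n t -> x << t -> y << t -> exists z, z << t /\ x << z /\ y << z.
Proof.
  intros [_ [_ [_ hs]]] hx hy. destruct (lt_or_le x y) as [h|h].
  - destruct (hs y hy) as [z [h1 h2]]. exists z. split; [|split]; auto. eapply lt_tr; eauto.
  - destruct (hs x hx) as [z [h1 h2]]. exists z. split; [|split]; auto. eapply le_lt; eauto.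
Qed.

(** The supremum of the chain obtained from [y] by iterating [step] countably often; it lies below
    [t] because [n] is infinite. All unboundedness proofs for clubs use it. *)
Lemma omega_sup (n t y : M) (step : M -> M -> Prop) : inf (seg n) -> succ_card n t -> y << t ->
  (forall z, z << t -> exists z', z' << t /\ z << z' /\ step z z') ->
  exists s, s << t /\ y << s /\
    forall x, x << s -> exists z z', x << z /\ z << z' /\ z' << s /\ step z z'.
Proof.
  intros hn ht hy hst.
  destruct (fun_choice_on (fun z => z << t) (fun z z' => z' << t /\ z << z' /\ step z z') M_inh hst)
    as [f hf].
  set (e := fix e k := match k with 0 => y | S k => f (e k) end).
  assert (he : forall k, e k << t).
  { induction k; simpl; auto. apply hf; auto. }
  destruct (bounding_fam n t (full nat) e ht hn (fun k _ => he k)) as [b [hb1 hb2]].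
  destruct (lub_exists (fun x => exists k, x = e k) b) as [s [h1 [h2 h3]]].
  { intros x [k ->]. apply ltW, hb2; exact I. }
  assert (hs : forall k, e k << s).
  { intros k. eapply lt_le; [apply (hf (e k)); auto|]. apply h2. exists (S k). reflexivity. }
  exists s. split; [eapply le_lt; eauto|]. split; [apply (hs 0)|].
  intros x hx. destruct (h3 x hx) as [z [[k ->] hz]]. exists (e k), (e (S k)).
  destruct (hf (e k) (he k)) as [_ [k1 k2]]. auto.
Qed.

(** For unboundedness, a step passes from [z] to a [z'] such that every [E x] has a point between
    them. The supremum of such steps is a limit point of all the [E x]. *)
Lemma club_inter (n t : M) {T : Type} (A : T -> Prop) (E : T -> M -> Prop) :
  inf (seg n) -> succ_card n t -> cle A (seg n) -> (forall x, A x -> club t (E x)) ->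
  club t (fun z => z << t /\ forall x, A x -> E x z).
Proof.
  intros hn ht hA hE. split; [tauto|split].
  - intros y hy.
    destruct (omega_sup n t y (fun z z' => forall x, A x -> exists e, E x e /\ z << e /\ e << z') hn ht hy)
      as [s [h1 [h2 h3]]].
    + intros z hz.
      destruct (fun_choice_on A (fun x e => E x e /\ z << e) M_inh) as [u hu].
      { intros x ax. apply (hE x ax); auto. }
      destruct (bounding_fam n t A u ht hA) as [b [hb1 hb2]].
      { intros x ax. apply (hE x ax). apply (hu x ax). }
      destruct (succ_above2 n t z b ht hz hb1) as [z' [k1 [k2 k3]]].
      exists z'. split; [|split]; auto. intros x ax. exists (u x).
      destruct (hu x ax). split; [|split]; auto. eapply lt_tr; eauto.
    + exists s. split; auto. split; auto. intros x ax. apply (hE x ax); auto.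
      intros y' hy'. destruct (h3 y' hy') as [z [z' [k1 [k2 [k3 k4]]]]].
      destruct (k4 x ax) as [e [l1 [l2 l3]]]. exists e.
      split; [|split]; auto; eapply lt_tr; eauto.
  - intros x hx hl. split; auto. intros a ha. apply (hE a ha); auto.
    intros y hy. destruct (hl y hy) as [e [[_ h] h']]. eauto.
Qed.

(** [e] is the projection of [g] to [E]: the last point of [E] not above [g]. *)
Definition isPr (E : M -> Prop) (g e : M) : Prop :=
  E e /\ e <<= g /\ forall e', E e' -> e' <<= g -> e' <<= e.

Lemma isPr_exists (t : M) (E : M -> Prop) (g : M) : club t E -> g << t -> exists e, isPr E g e.
Proof.
  intros [h1 [_ h3]] hg.
  destruct (lub_exists (fun e => E e /\ e <<= g) g) as [s [k1 [k2 k3]]]; [tauto|].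
  exists s. split; [|split; auto].
  apply NNPP. intros hn. apply hn. apply h3; [eapply le_lt; eauto|].
  intros y hy. destruct (k3 y hy) as [e [[he he'] hye]]. exists e. split; [|split]; auto.
  destruct (le_lt_or_eq e s) as [h| ->]; auto. contradiction.
Qed.

Section Guess.
Context (m t1 t2 t3 : M).
Hypothesis m_inf : inf (seg m).
Hypothesis st1 : succ_card m t1.
Hypothesis st2 : succ_card t1 t2.
Hypothesis st3 : succ_card t2 t3.

Lemma t2_inf : inf (seg t2).
Proof. eapply succ_inf; [eapply succ_inf; [exact m_inf|exact st1]|exact st2]. Qed.

Definition cofinal_in (A : M -> Prop) (al : M) : Prop :=
  (forall x, A x -> x << al) /\ (forall y, y << al -> exists x, A x /\ y << x).
(** The cofinality of [al] is exactly the successor of [|m|]. *)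
Definition good (al : M) : Prop :=
  (exists A, cofinal_in A al /\ cle A (seg t1)) /\
  (forall A, cofinal_in A al -> ~ cle A (seg m)).

(** Choose points of [E] increasingly along [t1]. Their supremum is below [t3] by regularity of
    [t3], and no set of size [|m|] is cofinal in it by regularity of [t1]. *)
Lemma good_limit (E : M -> Prop) : club t3 E -> exists al, al << t3 /\ good al /\ limpt E al.
Proof.
  intros hE.
  destruct (wf_rec_choice M M (fun s g b => s << t1 -> E b /\ forall s', s' << s -> g s' << b) M_inh)
    as [ep hep].
  - intros a g g' b hg h ha. destruct (h ha) as [h1 h2]. split; auto.
    intros s' hs'. rewrite <- hg; auto.
  - intros s g IH. destruct (classic (s << t1)) as [hs|hs]; [|exists s; tauto].
    destruct (bounding_fam t2 t3 (seg s) g st3) as [y [hy1 hy2]].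
    + apply seg_mono, ltW. eapply lt_tr; [exact hs|]. eapply succ_gt; exact st2.
    + intros x hx. apply hE. apply (IH x hx). eapply lt_tr; eauto.
    + destruct hE as [_ [hu _]]. destruct (hu y hy1) as [b [hb hyb]]. exists b. intros _.
      split; auto. intros s' hs'. eapply lt_tr; [apply hy2; auto|auto].
  - assert (hE' : forall s, s << t1 -> E (ep s)) by (intros s hs; apply (hep s hs)).
    assert (hinc : forall s s', s' << t1 -> s << s' -> ep s << ep s')
      by (intros s s' hs h; apply (hep s' hs); auto).
    destruct (bounding_fam t2 t3 (seg t1) ep st3) as [b [hb1 hb2]].
    { apply seg_mono, ltW. eapply succ_gt; exact st2. }
    { intros x hx. apply hE; auto. }
    destruct (lub_exists (fun x => exists s, s << t1 /\ x = ep s) b) as [al [h1 [h2 h3]]].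
    { intros x [s [hs ->]]. apply ltW, hb2; auto. }
    assert (hal : forall s, s << t1 -> ep s << al).
    { intros s hs. destruct st1 as [_ [_ [_ hnm]]]. destruct (hnm s hs) as [s' [k1 k2]].
      eapply lt_le; [apply (hinc s s'); auto|]. apply h2. eauto. }
    exists al. split; [eapply le_lt; eauto|]. split; [split|].
    + exists (fun x => exists s, seg t1 s /\ x = ep s). split; [split|apply cle_image].
      * intros x [s [hs ->]]. apply hal; auto.
      * exact h3.
    + intros A [hA1 hA2] hc.
      destruct (fun_choice_on A (fun x s => s << t1 /\ x << ep s) M_inh) as [u hu].
      { intros x ax. destruct (h3 x (hA1 x ax)) as [z [[s [hs ->]] hz]]. eauto. }
      destruct (bounding_fam m t1 A u st1 hc) as [s [hs1 hs2]].
      { intros x ax. apply hu; auto. }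
      destruct (hA2 (ep s) (hal s hs1)) as [x [ax hx]]. destruct (hu x ax) as [k1 k2].
      apply (lt_irr x). eapply lt_tr; [exact k2|]. eapply lt_tr; [|exact hx].
      apply hinc; auto.
    + intros y hy. destruct (h3 y hy) as [z [[s [hs ->]] hz]]. exists (ep s). auto.
Qed.

(** Shelah's argument: fix cofinal sets [A al] of size at most [|t1|] and try their projections to a
    club [E] as guesses. If every [E] fails, shrink it [t2] times. At a good limit [al] of all these
    clubs the projections of the points of [A al] stabilise at a common stage before [t2], and the
    guess made there succeeds after all. *)
Lemma club_guess_aux : exists c : M -> M -> Prop, forall E, club t3 E ->
  exists al, (forall x, c al x -> E x) /\ (forall x, c al x -> exists x', c al x' /\ x << x') /\
    ~ cle (c al) (seg m).
Proof.
  destruct (fun_choice_on (fun al => good al) (fun al A => cofinal_in A al /\ cle A (seg t1))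
    (inhabits (fun _ : M => True))) as [A hA].
  { intros al [h _]. exact h. }
  set (cc := fun (E : M -> Prop) al e => exists g, A al g /\ isPr E g e).
  assert (hcc : forall E al, club t3 E -> al << t3 -> good al -> limpt E al -> cofinal_in (cc E al) al).
  { intros E al hE ha hg hl. destruct (hA al hg) as [[k1 k2] _]. split.
    - intros e [g [hg1 [_ [h _]]]]. eapply le_lt; eauto.
    - intros y hy. destruct (hl y hy) as [e [he [h1 h2]]]. destruct (k2 e h2) as [g [hg1 hg2]].
      destruct (isPr_exists t3 E g hE) as [e' he']; [eapply lt_tr; eauto|].
      exists e'. split; [exists g; auto|]. eapply lt_le; [exact h1|]. apply he'; auto. apply ltW; auto. }
  apply NNPP. intros Hno.
  assert (HB : forall E, club t3 E -> exists E', club t3 E' /\ (forall x, E' x -> E x) /\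
    forall al, al << t3 -> good al -> limpt E al -> exists x, cc E al x /\ ~ E' x).
  { intros E hE. apply NNPP. intros hn. apply Hno. exists (fun al x => cc E al x).
    assert (hn' : forall E', club t3 E' -> exists al, al << t3 /\ good al /\ limpt E al /\
      forall x, cc E al x -> E' x).
    { intros E' hE'. apply NNPP. intros hh. apply hn.
      (* A club [E'] not guessed by the projections to [E] is replaced by its intersection with [E],
         so that the bad clubs decrease. *)
      exists (fun z => z << t3 /\ forall b : bool, full bool b -> (if b then E else E') z).
      split; [|split].
      - apply (club_inter t2); auto; [apply t2_inf| |intros []; auto].
        apply cle_fin_inf; [|apply t2_inf]. exists 2.
        apply (cle_fun_intro _ _ (fun b : bool => if b then 1 else 0)).
        + intros [] _; lia.
        + intros [] [] _ _; auto; discriminate.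
      - intros x [_ h]. exact (h true I).
      - intros al h1 h2 h3. apply NNPP. intros h4. apply hh. exists al.
        split; [|split; [|split]]; auto. intros x hx. apply NNPP. intros h5. apply h4.
        exists x. split; auto. intros [_ h6]. exact (h5 (h6 false I)). }
    intros E' hE'. destruct (hn' E' hE') as [al [h1 [h2 [h3 h4]]]]. exists al.
    pose proof (hcc E al hE h1 h2 h3) as hcof. split; [|split]; auto.
    - intros x hx. destruct hcof as [k1 k2]. apply k2. apply k1; auto.
    - apply h2; auto. }
  destruct (fun_choice_on (club t3) _ (inhabits (fun _ : M => True)) HB) as [Bad hBad].
  (* [F xi] is the intersection of the clubs [Bad (F eta)] for [eta] below [xi], so it lies inside
     the refutation of each earlier guess. *)
  destruct (wf_rec_choice M (M -> Prop)
    (fun xi g b => forall z, b z <-> (z << t3 /\ forall eta, seg xi eta -> Bad (g eta) z))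
    (inhabits (fun _ : M => True))) as [F hF].
  { intros a g g' b hg h z. rewrite (h z). split; intros [h1 h2]; (split; [auto|]); intros eta he;
      [rewrite <- hg|rewrite hg]; auto. }
  { intros a g _. exists (fun z => z << t3 /\ forall eta, seg a eta -> Bad (g eta) z). tauto. }
  assert (hFc : forall xi, xi << t2 -> club t3 (F xi)).
  { intros xi. induction xi as [xi IH] using (well_founded_ind lt_wf). intros hxi.
    eapply club_ext; [intros z; symmetry; apply hF|].
    apply (club_inter t2); auto; [apply t2_inf|apply seg_mono, ltW; auto|].
    intros eta he. apply hBad, IH; auto. eapply lt_tr; eauto. }
  assert (hdec : forall xi eta z, xi << t2 -> eta << xi -> F xi z -> Bad (F eta) z).
  { intros xi eta z hxi he hz. apply (hF xi z) in hz. apply hz; auto. }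
  assert (hdec' : forall xi eta z, xi << t2 -> eta << xi -> F xi z -> F eta z).
  { intros xi eta z hxi he hz. destruct (hBad (F eta)) as [_ [h _]].
    - apply hFc. eapply lt_tr; eauto.
    - apply h. eapply hdec; eauto. }
  destruct (good_limit (fun z => z << t3 /\ forall xi, seg t2 xi -> F xi z)) as [al [ha [hg hl]]].
  { apply (club_inter t2); auto; [apply t2_inf|apply cle_refl]. }
  destruct (hA al hg) as [[k1 k2] k3].
  (* The projections to the decreasing clubs [F xi] stabilise. *)
  assert (hst : forall g, A al g -> exists xg, xg << t2 /\
     forall xi xi' e, xg <<= xi -> xi << xi' -> xi' << t2 -> isPr (F xi) g e -> F xi' e).
  { intros g hgA. assert (hgt : g << t3) by (eapply lt_tr; eauto).
    destruct (wf_min (fun e => exists xi, xi << t2 /\ isPr (F xi) g e)) as [e [[xg [hx he]] hmin]].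
    { assert (h0 : m << t2) by (eapply lt_tr; eapply succ_gt; eauto).
      destruct (isPr_exists t3 (F m) g (hFc m h0) hgt) as [e he]. eauto. }
    exists xg. split; auto. intros xi xi' e1 h1 h2 h3 h4.
    assert (hpr : forall x, xg <<= x -> x << t2 -> isPr (F x) g e).
    { intros x hx1 hx2. destruct (isPr_exists t3 (F x) g (hFc x hx2) hgt) as [e2 he2].
      replace e with e2; auto. apply le_anti; [|apply hmin; eauto].
      destruct he as [_ [_ he]]. destruct he2 as [l1 [l2 _]]. apply he; auto.
      destruct (le_lt_or_eq _ _ hx1) as [l| <-]; auto. eapply hdec'; eauto. }
    assert (hxi : xi << t2) by (eapply lt_tr; eauto).
    replace e1 with e.
    - apply hpr; auto. eapply le_tr; [exact h1|apply ltW; auto].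
    - destruct (hpr xi h1 hxi) as [l1 [l2 l3]]. destruct h4 as [n1 [n2 n3]].
      apply le_anti; auto. }
  destruct (fun_choice_on (A al) _ M_inh hst) as [u hu].
  destruct (bounding_fam t1 t2 (A al) u st2 k3) as [xi [hx1 hx2]].
  { intros g h. apply hu; auto. }
  destruct st2 as [_ [_ [_ hnm]]]. destruct (hnm xi hx1) as [xi' [hx3 hx4]].
  destruct (hBad (F xi) (hFc xi hx1)) as [_ [_ hb]].
  destruct (hb al ha hg) as [x [[g [hgA hpr]] hx]].
  { intros y hy. destruct (hl y hy) as [e [[_ he] h']]. exists e. auto. }
  apply hx. apply (hdec xi'); auto. apply (hu g hgA) with (xi := xi); auto. apply ltW; auto.
Qed.
End Guess.

Lemma club_guessing (m : M) : inf (seg m) -> exists n t (c : M -> M -> Prop),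
  inf (seg n) /\ succ_card n t /\ forall E, club t E ->
  exists al, (forall x, c al x -> E x) /\ (forall x, c al x -> exists x', c al x' /\ x << x') /\
    ~ cle (c al) (seg m).
Proof.
  intros hm. destruct (succ_exists m hm) as [t1 st1].
  assert (i1 := succ_inf _ _ hm st1). destruct (succ_exists t1 i1) as [t2 st2].
  assert (i2 := succ_inf _ _ i1 st2). destruct (succ_exists t2 i2) as [t3 st3].
  destruct (club_guess_aux m t1 t2 t3 hm st1 st2 st3) as [c hc].
  exists t2, t3, c. auto.
Qed.

(** * Increasing sequences modulo bounded sets *)

Definition ev (P : C -> Prop) : Prop := exists i0, forall i, i0 <<= i -> P i.
Definition les (x y : C -> M) : Prop := ev (fun i => x i <<= y i).
Definition lts (x y : C -> M) : Prop := ev (fun i => x i << y i).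

Lemma ev_all (P : C -> Prop) : (forall i, P i) -> ev P.
Proof. intros h. destruct C_inh as [c]. exists c. auto. Qed.

Lemma ev_imp (P Q : C -> Prop) : (forall i, P i -> Q i) -> ev P -> ev Q.
Proof. intros h [i0 h0]. exists i0. auto. Qed.

Lemma ev_and (P Q : C -> Prop) : ev P -> ev Q -> ev (fun i => P i /\ Q i).
Proof.
  intros [i hi] [j hj]. destruct (max2 i j) as [k [h1 h2]]. exists k.
  intros l hl. split; [apply hi|apply hj]; eapply le_tr; eauto.
Qed.

Lemma ev_imp2 (P Q S : C -> Prop) : (forall i, P i -> Q i -> S i) -> ev P -> ev Q -> ev S.
Proof. intros h hP hQ. eapply ev_imp; [|exact (ev_and _ _ hP hQ)]. intros i []; auto. Qed.

Lemma ev_freq (P Q : C -> Prop) : ~ ev P -> ev Q -> exists i, ~ P i /\ Q i.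
Proof.
  intros hP [i0 h0]. apply NNPP. intros hn. apply hP. exists i0. intros i hi.
  apply NNPP. intros h. apply hn. eauto.
Qed.

Lemma les_refl x : les x x.
Proof. apply ev_all. intros; apply le_refl. Qed.
Lemma les_tr x y z : les x y -> les y z -> les x z.
Proof. apply ev_imp2. intros i. apply le_tr. Qed.
Lemma lts_les x y : lts x y -> les x y.
Proof. apply ev_imp. intros i. apply ltW. Qed.
Lemma lts_les_tr x y z : lts x y -> les y z -> lts x z.
Proof. apply ev_imp2. intros i. apply lt_le. Qed.
Lemma lts_tr x y z : lts x y -> lts y z -> lts x z.
Proof. apply ev_imp2. intros i. apply lt_tr. Qed.

(** [mm i] is the least ordinal that is at least [m0] and exceeds [cofM] up to [i]; leastness gives
    monotonicity. *)
Lemma mm_exists (m0 : M) : exists mm : C -> M, (forall i, m0 <<= mm i) /\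
  (forall i j, i <<= j -> mm i <<= mm j) /\ (forall x, exists i, x << mm i).
Proof.
  set (P := fun i y => m0 <<= y /\ forall d, d <<= i -> cofM d << y).
  destruct (fun_choice (fun i y => P i y /\ forall z, P i z -> y <<= z)) as [mm h].
  { intros i. apply wf_min. destruct (initial_bounded_M cofM i) as [y hy].
    destruct (max2 m0 y) as [z [h1 h2]]. exists z. split; auto. intros d hd. eapply lt_le; eauto. }
  exists mm. split; [|split].
  - intros i. apply h.
  - intros i j hij. apply (h i). destruct (h j) as [[h1 h2] _]. split; auto.
    intros d hd. apply h2. eapply le_tr; eauto.
  - intros x. destruct (cofM_cofinal x) as [d hd]. exists d. eapply lt_tr; [exact hd|].
    apply h. apply le_refl.
Qed.

Section Increasing.
Context (m0 : M) (mm lam : C -> M).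
Hypothesis m0_inf : inf (seg m0).
Hypothesis m0_C : cle (full C) (seg m0).
Hypothesis mm_ge : forall i, m0 <<= mm i.
Hypothesis mm_mono : forall i j, i <<= j -> mm i <<= mm j.
Hypothesis mm_cof : forall x, exists i, x << mm i.
Hypothesis lam_succ : forall i, succ_card (mm i) (lam i).

Lemma inf_ge (m : M) : m0 <<= m -> inf (seg m).
Proof. intros h. eapply inf_mono; [exact m0_inf|apply seg_mono; auto]. Qed.

Definition limit (d : K) : Prop := forall g, g << d -> exists g', g' << d /\ g << g'.

(** Singularity enters here: [d] injects into [M], hence is a union of [|C|] slices of size below
    [|M|]. Either one slice is cofinal in [d], or bounds of the slices form a cofinal set of size at
    most [|C|]. *)
Lemma small_cofinal (d : K) : exists (B : K -> Prop) (c : C), cle B (seg (mm c)) /\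
  (limit d -> (forall x, B x -> x << d) /\ (forall y, y << d -> exists x, B x /\ y << x)).
Proof.
  destruct C_inh as [c0].
  destruct (classic (limit d)) as [hl|hl].
  2:{ exists (fun _ => False), c0. split; [|tauto]. exists (fun _ _ => True). tauto. }
  destruct (cle_fun _ _ M_inh (K_seg d)) as [e [_ e2]].
  destruct (classic (exists c, forall y, y << d -> exists x, (x << d /\ e x << cofM c) /\ y << x))
    as [[c hc]|hn].
  - exists (fun x => x << d /\ e x << cofM c). destruct (mm_cof (cofM c)) as [i hi]. exists i.
    split; [|intros _; split; [tauto|exact hc]].
    apply (cle_fun_intro _ _ e).
    + intros x [_ h]. eapply lt_tr; eauto.
    + intros x x' [h _] [h' _]. apply e2; auto.
  - assert (hb : forall c, exists b, b << d /\ forall x, x << d -> e x << cofM c -> x <<= b).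
    { intros c. apply NNPP. intros h. apply hn. exists c. intros y hy. apply NNPP. intros h'.
      apply h. exists y. split; auto. intros x h1 h2 h3. apply h'. eauto. }
    destruct (fun_choice _ hb) as [b hb'].
    exists (fun x => exists c, full C c /\ x = b c), c0. split.
    + eapply cle_trans; [apply cle_image|]. eapply cle_trans; [exact m0_C|apply seg_mono; auto].
    + intros _. split; [intros x [c [_ ->]]; apply hb'|].
      intros y hy. destruct (hl y hy) as [y' [h1 h2]]. destruct (cofM_cofinal (e y')) as [c hc].
      exists (b c). split; [exists c; split; [exact I|auto]|]. eapply lt_le; [exact h2|].
      apply hb'; auto.
Qed.

Lemma increasing_exists : exists f : K -> C -> M,
  (forall d i, f d i << lam i) /\ (forall g d, g << d -> lts (f g) (f d)) /\
  (forall d, limit d -> exists B : K -> Prop,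
    (forall x, B x -> x << d) /\ (forall y, y << d -> exists x, B x /\ y << x) /\
    ev (fun i => forall g, g << d -> limpt B g -> f g i <<= f d i)).
Proof.
  destruct (fun_choice (fun d Bc => cle (fst Bc) (seg (mm (snd Bc))) /\
    (limit d -> (forall x, fst Bc x -> x << d) /\ (forall y, y << d -> exists x, fst Bc x /\ y << x))))
    as [Bc hBc].
  { intros d. destruct (small_cofinal d) as [B [c h]]. exists (B, c). exact h. }
  set (B := fun d => fst (Bc d)). set (cc := fun d => snd (Bc d)).
  destruct (fun_choice _ (fun d => cle_fun _ _ M_inh (K_seg d))) as [e he].
  (* The earlier [g] to be beaten at coordinate [i]. The first group grows to all of [d] and makes
     [f] increasing modulo bounded sets; the second gives domination along a small club of [d]. Both
     have size at most [|mm i|], hence are bounded below [lam i]. *)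
  set (rel := fun d i g => g << d /\ e d g << mm i \/
    (g << d /\ limpt (B d) g) /\ limit d /\ cc d <<= i).
  destruct (wf_rec_choice K (C -> M) (fun d g b => forall i, b i << lam i /\
    forall x, rel d i x -> g x i << b i) (inhabits mm)) as [f hf].
  - intros d g g' b hg h i. destruct (h i) as [h1 h2]. split; auto.
    intros x hx. rewrite <- hg; auto. destruct hx as [[? _]|[[? _] _]]; auto.
  - intros d g IH.
    apply (fun_choice (fun i y => y << lam i /\ forall x, rel d i x -> g x i << y)).
    intros i. apply (bounding_fam (mm i)); auto.
    + destruct (he d) as [_ he2]. apply cle_union; [apply inf_ge; auto|apply square_seg, inf_ge; auto| |].
      * apply (cle_fun_intro _ _ (e d)); [intros x [_ h]; exact h|].
        intros x x' [h _] [h' _]. apply he2; auto.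
      * destruct (classic (limit d /\ cc d <<= i)) as [[h1 h2]|h].
        -- destruct (hBc d) as [k1 k2]. destruct (k2 h1) as [_ k3].
           eapply cle_trans; [apply cle_sub; intros x [h _]; exact h|].
           eapply cle_trans; [apply cle_limpt; exact k3|].
           eapply cle_trans; [exact k1|]. apply seg_mono, mm_mono; auto.
        -- exists (fun _ _ => True). split; intros x; tauto.
    + intros x hx. apply IH. destruct hx as [[? _]|[[? _] _]]; auto.
  - exists f. split; [intros; apply hf|split].
    + intros g d h. destruct (mm_cof (e d g)) as [i0 h0]. exists i0. intros i hi.
      apply (hf d i). left. split; auto. eapply lt_le; [exact h0|auto].
    + intros d hl. exists (B d). destruct (hBc d) as [_ k]. destruct (k hl) as [k1 k2].
      split; [|split]; auto. exists (cc d). intros i hi g hg hlg. apply ltW, (hf d i).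
      right. auto.
Qed.

(** * The bounding projection property *)

Section Projection.
Context (f : K -> C -> M).
Hypothesis f_lam : forall d i, f d i << lam i.
Hypothesis f_inc : forall g d, g << d -> lts (f g) (f d).
Hypothesis f_lim : forall d, limit d -> exists B : K -> Prop,
    (forall x, B x -> x << d) /\ (forall y, y << d -> exists x, B x /\ y << x) /\
    ev (fun i => forall g, g << d -> limpt B g -> f g i <<= f d i).

Lemma f_mono (g d : K) : g <<= d -> les (f g) (f d).
Proof.
  intros h. destruct (le_lt_or_eq _ _ h) as [h'| ->]; [apply lts_les; auto|apply les_refl].
Qed.

Definition ub (G : C -> M) : Prop := forall d, les (f d) G.

(** [y i] is the least element of [S i] above or equal to [x i], where [lam i] is added to [S i] so
    that one exists. *)
Definition is_proj (S : C -> M -> Prop) (x y : C -> M) : Prop :=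
  forall i, (S i (y i) \/ y i = lam i) /\ x i <<= y i /\
    forall v, S i v \/ v = lam i -> x i <<= v -> y i <<= v.

Lemma proj_exists (S : C -> M -> Prop) (d : K) : exists y, is_proj S (f d) y.
Proof.
  apply (fun_choice (fun i y => (S i y \/ y = lam i) /\ f d i <<= y /\
    forall v, S i v \/ v = lam i -> f d i <<= v -> y <<= v)).
  intros i. destruct (wf_min (fun v => (S i v \/ v = lam i) /\ f d i <<= v)) as [y [[h1 h2] h3]].
  - exists (lam i). split; auto. apply ltW; auto.
  - exists y. auto.
Qed.

Section Ladder.
Context (n t : M) (c : M -> M -> Prop) (pr : K -> C -> M).
Hypothesis n_inf : inf (seg n).
Hypothesis n_t : succ_card n t.
Hypothesis no_bound : forall d, exists d', ~ les (f d') (pr d).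
Hypothesis pr_ge : forall d i, f d i <<= pr d i.

Definition dominates (xi : M -> K) (al i : M) (s : K) : Prop :=
  ev (fun j => forall k, c al k -> k <<= i -> f (xi k) j <<= f s j).

(** Recursion along [M]. One [sg i] serves every [al] at once, because there are only [|M|] of them
    and [K] is regular; [ta i] comes from the failure of [pr (sg i)] to be a bound. *)
Lemma ladder_exists : exists xi sg ta : M -> K,
  (forall i, (forall i', i' << i -> ta i' <<= xi i) /\
             (forall y, y << xi i -> exists i', i' << i /\ y << ta i')) /\
  (forall i, xi i << sg i) /\
  (forall i al, (exists s, dominates xi al i s) -> dominates xi al i (sg i)) /\
  (forall i, sg i << ta i /\ ~ les (f (ta i)) (pr (sg i))).
Proof.
  (* [dom] is [dominates] with the current value [x] of [xi] split off, so that [g] is consulted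
     only strictly below [i]. *)
  set (dom := fun (g : M -> K * (K * K)) x al i s =>
    ev (fun j => (forall k, c al k -> k << i -> f (fst (g k)) j <<= f s j) /\
                 (c al i -> f x j <<= f s j))).
  destruct (wf_rec_choice M (K * (K * K)) (fun i g b =>
    let x := fst b in let s := fst (snd b) in let u := snd (snd b) in
    ((forall i', i' << i -> snd (snd (g i')) <<= x) /\
     (forall y, y << x -> exists i', i' << i /\ y << snd (snd (g i')))) /\
    x << s /\ (forall al, (exists s', dom g x al i s') -> dom g x al i s) /\
    s << u /\ ~ les (f u) (pr s))) as [F hF].
  - destruct K_inh as [k]. exact (inhabits (k, (k, k))).
  - intros i g g' [x [s u]] hg. simpl. intros [[h1 h2] [h3 [h4 h5]]]. split; [split|split; [|split]]; auto.
    + intros i' hi'. rewrite <- hg; auto.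
    + intros y hy. destruct (h2 y hy) as [i' [k1 k2]]. exists i'. rewrite <- hg; auto.
    + assert (hd : forall al s', dom g x al i s' <-> dom g' x al i s').
      { intros al s'. split; apply ev_imp; intros j [k1 k2]; (split; [|auto]); intros k hk hki;
          [rewrite <- hg|rewrite hg]; auto. }
      intros al [s' hs']. apply hd, h4. exists s'. apply hd; auto.
  - intros i g _.
    destruct (bounded_K (seg i) (fun i' => snd (snd (g i')))) as [b hb].
    { apply cle_sub. intros; exact I. }
    destruct (lub_exists (fun y => exists i', i' << i /\ y = snd (snd (g i'))) b) as [x [_ [h2 h3]]].
    { intros y [i' [h ->]]. apply ltW, hb; auto. }
    destruct (fun_choice_on (fun al => exists s', dom g x al i s') (fun al s' => dom g x al i s') K_inh)
      as [sa hsa]; [auto|].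
    destruct (bounded_K (fun al => exists s', dom g x al i s') sa) as [b' hb'].
    { apply cle_sub. intros; exact I. }
    destruct (max2 b' x) as [b2 [l1 l2]]. destruct (K_nomax b2) as [s hs].
    destruct (no_bound s) as [u hu]. exists (x, (s, u)). simpl. split; [split|split; [|split; [|split]]]; auto.
    + intros i' hi'. apply h2. eauto.
    + intros y hy. destruct (h3 y hy) as [z [[i' [k1 ->]] k2]]. eauto.
    + eapply le_lt; eauto.
    + intros al hal. specialize (hsa al hal). specialize (hb' al hal).
      assert (hm : les (f (sa al)) (f s)).
      { apply f_mono, ltW. eapply lt_tr; [exact hb'|]. eapply le_lt; eauto. }
      revert hsa hm. apply ev_imp2. intros j [k1 k2] k3. split.
      * intros k hk hki. eapply le_tr; [apply k1; auto|auto].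
      * intros hk. eapply le_tr; [apply k2; auto|auto].
    + destruct (lt_or_le s u) as [h|h]; auto. exfalso. apply hu.
      eapply les_tr; [apply f_mono; exact h|]. apply ev_all. auto.
  - exists (fun i => fst (F i)), (fun i => fst (snd (F i))), (fun i => snd (snd (F i))).
    split; [|split; [|split]].
    + intros i. apply (hF i).
    + intros i. apply (hF i).
    + assert (hd : forall al i s, dom F (fst (F i)) al i s <-> dominates (fun i => fst (F i)) al i s).
      { intros al i s. split; apply ev_imp.
        - intros j [k1 k2] k hk hki. destruct (le_lt_or_eq _ _ hki) as [h| ->]; auto.
        - intros j h. split; [intros; apply h; auto; apply ltW; auto|].
          intros hk. apply h; auto. apply le_refl. }
      intros i al [s hs]. apply hd. apply (hF i). exists s. apply hd; auto.
    + intros i. apply (hF i).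
Qed.

(* The bound of [f] along the limit points of a small cofinal set of [d = sup xi]
   is reflected below [d] by the ladder, on every guessed initial segment. *)
Lemma ladder_guess (m : M) :
  (forall E, club t E -> exists al, (forall x, c al x -> E x) /\
     (forall x, c al x -> exists x', c al x' /\ x << x') /\ ~ cle (c al) (seg m)) ->
  exists (D : M -> Prop) (sg : M -> K) (jj : M -> C), ~ cle D (seg m) /\
    forall i i', D i -> D i' -> i << i' -> jj i = jj i' -> pr (sg i) (jj i) << pr (sg i') (jj i).
Proof.
  intros Hguess. destruct ladder_exists as [xi [sg [ta [h1 [h2 [h3 h4]]]]]].
  assert (xi_inc : forall i i', i << i' -> xi i << xi i').
  { intros i i' h. destruct (h1 i') as [k _]. eapply lt_le; [|apply k; exact h].
    eapply lt_tr; [apply h2|apply h4]. }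
  destruct (bounded_K (seg t) xi) as [b hb]; [apply cle_sub; intros; exact I|].
  destruct (lub_exists (fun y => exists i, i << t /\ y = xi i) b) as [d [_ [l2 l3]]].
  { intros y [i [hi ->]]. apply ltW, hb; auto. }
  assert (t_nomax : forall i, i << t -> exists i', i' << t /\ i << i') by apply n_t.
  assert (xi_d : forall i, i << t -> xi i << d).
  { intros i hi. destruct (t_nomax i hi) as [i' [k1 k2]].
    eapply lt_le; [apply xi_inc; exact k2|]. apply l2. eauto. }
  destruct (f_lim d) as [B [B1 [B2 B3]]].
  { intros g hg. destruct (l3 g hg) as [z [[i [hi ->]] hz]]. exists (xi i). auto. }
  (* The indices whose [xi i] is a limit point of [B] form a club, since [xi] is continuous and [B]
     is interleaved with it cofinally. *)
  destruct (Hguess (fun i => i << t /\ limpt B (xi i))) as [al [a1 [a2 a3]]].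
  { split; [tauto|split].
    - intros i hi.
      destruct (omega_sup n t i (fun z z' => exists x, B x /\ xi z << x /\ x << xi z') n_inf n_t hi)
        as [s [k1 [k2 k3]]].
      + intros z hz. destruct (B2 (xi z) (xi_d z hz)) as [x [hx hzx]].
        destruct (l3 x (B1 x hx)) as [w [[z' [hz' ->]] hw]].
        exists z'. split; [|split]; eauto.
        destruct (lt_or_le z z') as [h|h]; auto. exfalso.
        assert (hc : xi z << xi z') by (eapply lt_tr; eauto).
        destruct (le_lt_or_eq _ _ h) as [h'| ->]; [|exact (lt_irr _ hc)].
        exact (lt_irr _ (lt_tr _ _ _ hc (xi_inc _ _ h'))).
      + exists s. split; [split|]; auto. intros y hy. destruct (h1 s) as [_ k4].
        destruct (k4 y hy) as [i' [k5 k6]]. destruct (k3 i' k5) as [z [z' [q1 [q2 [q3 [x [q4 [q5 q6]]]]]]]].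
        exists x. split; [|split]; auto.
        * eapply lt_tr; [exact k6|]. eapply le_lt; [apply (h1 z); exact q1|auto].
        * eapply lt_tr; [exact q6|]. auto.
    - intros i hi hl. split; auto. intros y hy. destruct (h1 i) as [_ k4].
      destruct (k4 y hy) as [i' [k5 k6]]. destruct (hl i' k5) as [e [[k7 k8] [k9 k10]]].
      destruct (k8 y) as [x [q1 [q2 q3]]].
      { eapply lt_le; [exact k6|]. apply (h1 e); auto. }
      exists x. split; [|split]; auto. eapply lt_tr; [exact q3|]. auto. }
  assert (hdom : forall i, c al i -> dominates xi al i (sg i)).
  { intros i _. apply h3. exists d. revert B3. apply ev_imp. intros j hj k hk _.
    destruct (a1 k hk). apply hj; auto. }
  (* [jj i] is a coordinate where [f (ta i)] exceeds [pr (sg i)] although all eventual inequalities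
     already hold there; [i'] is the next guessed index after [i]. *)
  destruct (fun_choice_on (c al) (fun i j =>
    (forall k, c al k -> k <<= i -> f (xi k) j <<= f (sg i) j) /\
    exists i', c al i' /\ (forall i2, c al i2 -> i << i2 -> i' <<= i2) /\ pr (sg i) j << f (xi i') j)
    C_inh) as [jj hjj].
  { intros i hi. destruct (wf_min (fun i' => c al i' /\ i << i')) as [i' [[k1 k2] k3]]; [auto|].
    assert (hm : les (f (ta i)) (f (xi i'))) by (apply f_mono, (h1 i'); auto).
    destruct (ev_freq _ _ (proj2 (h4 i)) (ev_and _ _ (hdom i hi) hm)) as [j [q1 [q2 q3]]].
    exists j. split; auto. exists i'. split; [|split]; auto.
    destruct (lt_or_le (pr (sg i) j) (f (xi i') j)) as [h|h]; auto.
    exfalso. apply q1. eapply le_tr; eauto. }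
  exists (c al), sg, jj. split; auto. intros i i' hi hi' hlt e.
  destruct (hjj i hi) as [_ [i1 [k1 [k2 k3]]]]. destruct (hjj i' hi') as [k4 _].
  eapply lt_le; [exact k3|]. rewrite e. eapply le_tr; [apply k4; auto|]. apply pr_ge.
Qed.
End Ladder.

(** Otherwise the ladder yields more than [|m|] indices. Those sharing a coordinate [j] have
    strictly increasing values in [S j] with [lam j] added, so there are at most [|m|] of them, and
    there are only [|C|] coordinates. *)
Lemma bounding_projection (m : M) (S : C -> M -> Prop) : m0 <<= m ->
  (forall i, cle (S i) (seg m)) -> exists d y, is_proj S (f d) y /\ ub y.
Proof.
  intros hm hS. assert (mi := inf_ge m hm).
  destruct (fun_choice _ (proj_exists S)) as [pr hpr].
  apply NNPP. intros Hno. destruct (club_guessing m mi) as [n [t [c [ni [nt hc]]]]].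
  destruct (ladder_guess n t c pr ni nt) with (m := m) as [D [sg [jj [hD hj]]]]; auto.
  { intros d. apply NNPP. intros hn. apply Hno. exists d, (pr d). split; auto.
    intros d'. apply NNPP. eauto. }
  { intros d i. apply hpr. }
  apply hD. eapply cle_trans; [|apply (square_seg M m mi)].
  apply (cle_trans _ (prodS (full C) (seg m)));
    [|apply cle_prod; [eapply cle_trans; [exact m0_C|apply seg_mono; auto]|apply cle_refl]].
  apply (cle_family _ _ (fun j i => D i /\ jj i = j)).
  - intros i hi. exists (jj i). split; [exact I|auto].
  - intros j _. apply (cle_trans _ (fun v => S j v \/ v = lam j));
      [|apply cle_add1_gen; auto].
    apply (cle_fun_intro _ _ (fun i => pr (sg i) j)).
    + intros i _. apply hpr.
    + intros i i' [h1 h2] [h3 h4] e. apply NNPP. intros hne.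
      destruct (neq_lt _ _ hne) as [h|h].
      * pose proof (hj i i' h1 h3 h ltac:(congruence)) as h5. rewrite h2, e in h5. exact (lt_irr _ h5).
      * pose proof (hj i' i h3 h1 h ltac:(congruence)) as h5. rewrite h4, e in h5. exact (lt_irr _ h5).
Qed.

(** * The exact upper bound *)

(** Once a projection bounds the whole sequence, later projections to the same sets agree with it
    eventually. *)
Lemma proj_eventual (S : C -> M -> Prop) (d d' : K) (y y' : C -> M) : d <<= d' ->
  is_proj S (f d) y -> ub y -> is_proj S (f d') y' -> les y y' /\ les y' y.
Proof.
  intros hd hy hu hy'. split.
  - generalize (f_mono d d' hd). apply ev_imp. intros i hi.
    destruct (hy i) as [_ [_ h]]. destruct (hy' i) as [k1 [k2 _]]. apply h; auto.
    eapply le_tr; eauto.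
  - generalize (hu d'). apply ev_imp. intros i hi. apply (hy' i); auto. apply (hy i).
Qed.

Definition lub (g : C -> M) : Prop := ub g /\ forall b, ub b -> les g b.

(** If no bound is least, build bounds [F a] for [a] below the successor [t] of [m0]: a projection
    [G] to the values of the earlier ones is a bound, and [F a] is a bound witnessing that [G] is
    not least. Projecting a single late [f d] to these growing value sets gives functions [H a]
    decreasing in [a], which stabilise below [t]. At a stable [a] the projection [G] lies below
    [F a] after all. *)
Lemma lub_function_exists : exists g, lub g.
Proof.
  apply NNPP. intros Hno. destruct (succ_exists m0 m0_inf) as [t st].
  assert (t_nomax : forall i, i << t -> exists i', i' << t /\ i << i') by apply st.
  set (SS := fun (a : M) (g : M -> C -> M) i v => exists b, b << a /\ v = g b i).
  set (Q := fun a g d G => is_proj (SS a g) (f d) G /\ ub G).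
  destruct (wf_rec_choice M (C -> M) (fun a g b => a << t ->
     exists d G, Q a g d G /\ ub b /\ ~ les G b) (inhabits lam)) as [F hF].
  - intros a g g' b hg h ha. destruct (h ha) as [d [G [[hQ hu] h']]]. exists d, G. split; auto.
    split; auto. intros i. destruct (hQ i) as [k1 [k2 k3]].
    assert (hs : forall v, SS a g i v <-> SS a g' i v).
    { intros v. split; intros [x [hx ->]]; exists x; (split; [auto|]); [rewrite hg|rewrite <- hg]; auto. }
    split; [destruct k1; [left; apply hs|]; auto|split; auto].
    intros v [hv|hv]; auto. apply k3. left. apply hs; auto.
  - intros a g _. destruct (classic (a << t)) as [ha|ha]; [|exists lam; tauto].
    destruct (bounding_projection m0 (SS a g) (le_refl _)) as [d [G [h1 h2]]].
    { intros i. eapply cle_trans; [apply (cle_image (seg a) (fun b => g b i))|]. apply st; auto. }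
    apply NNPP. intros hn. apply Hno. exists G. split; auto. intros b hb. apply NNPP. intros h.
    apply hn. exists b. intros _. exists d, G. split; [split|]; auto.
  - destruct (fun_choice_on (fun a => a << t) (fun a q => Q a F (fst q) (snd q) /\ ub (F a) /\
      ~ les (snd q) (F a))) as [q hq].
    { destruct K_inh as [k]. exact (inhabits (k, lam)). }
    { intros a ha. destruct (hF a ha) as [d [G h]]. exists (d, G). exact h. }
    destruct (bounded_K (seg t) (fun a => fst (q a))) as [d hd]; [apply cle_sub; intros; exact I|].
    destruct (fun_choice (fun a H => is_proj (SS a F) (f d) H)) as [H hH].
    { intros a. apply proj_exists. }
    assert (Hmono : forall a b i, a <<= b -> H b i <<= H a i).
    { intros a b i hab. destruct (hH a i) as [k1 [k2 _]]. destruct (hH b i) as [_ [_ k3]].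
      apply k3; auto. destruct k1 as [[x [hx e]]|k1]; auto. left. exists x. split; auto.
      eapply lt_le; eauto. }
    assert (Hst : forall i, exists a, a << t /\ forall b, b << t -> a <<= b -> H b i = H a i).
    { intros i. destruct (wf_min (fun v => exists a, a << t /\ v = H a i)) as [v [[a [ha ->]] hv]].
      - exists (H m0 i), m0. split; auto. apply (succ_gt _ _ st).
      - exists a. split; auto. intros b hb hab. apply le_anti; auto. apply hv; eauto. }
    destruct (fun_choice _ Hst) as [st' hst'].
    destruct (bounding_fam m0 t (full C) st' st m0_C) as [a [ha1 ha2]].
    { intros i _. apply hst'. }
    destruct (t_nomax a ha1) as [b [hb1 hb2]].
    destruct (hq a ha1) as [[qa1 qa2] [qa3 qa4]]. destruct (hq b hb1) as [[qb1 qb2] _].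
    apply qa4.
    destruct (proj_eventual _ _ d _ (H a) (ltW _ _ (hd a ha1)) qa1 qa2 (hH a)) as [e1 _].
    destruct (proj_eventual _ _ d _ (H b) (ltW _ _ (hd b hb1)) qb1 qb2 (hH b)) as [e2 e2'].
    eapply les_tr; [exact e1|]. apply (les_tr _ (H b)).
    { apply ev_all. intros i. destruct (hst' i) as [_ k].
      assert (hai : st' i <<= a) by (apply ltW, ha2; exact I).
      rewrite (k a ha1 hai), (k b hb1); [apply le_refl|]. eapply le_tr; [exact hai|apply ltW; auto]. }
    generalize (qa3 d). apply ev_imp. intros i hi. apply (hH b i); auto. left. exists a. auto.
Qed.

Lemma lub_gt (g : C -> M) (d : K) : lub g -> lts (f d) g.
Proof.
  intros [hu _]. destruct (K_nomax d) as [d' h]. eapply lts_les_tr; [apply f_inc; exact h|apply hu].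
Qed.

(** Project to the singletons of the values [h i]. Where [f d i] is not above [h i], the projection
    is at most [h i], which is below [g i]; but it is a bound and so eventually at least [g i]. *)
Lemma lub_exact (g h : C -> M) : lub g -> lts h g -> exists d, lts h (f d).
Proof.
  intros [hu hl] hh. destruct (bounding_projection m0 (fun i v => h i = v) (le_refl _)) as [d [y [h1 h2]]].
  { intros i. apply cle_fin_inf; auto. exists 1. exists (fun _ _ => True).
    split; [intros x _; exists 0; split; auto|intros; congruence]. }
  exists d. generalize hh (hl y h2). apply ev_imp2. intros i k1 k2.
  destruct (lt_or_le (h i) (f d i)) as [k|k]; auto. exfalso.
  destruct (h1 i) as [_ [_ k3]]. apply (k3 (h i)) in k; auto.
  apply k. eapply lt_le; eauto.
Qed.

(** Project to small sets unbounded in [g i] at the bad coordinates, and to the empty set elsewhere.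
    At a bad coordinate the projection of [f d] falls below [g i], although it is eventually at
    least [g i]. *)
Lemma lub_bounding (g : C -> M) (m : M) : lub g -> m0 <<= m -> ev (fun i => bounding m (g i)).
Proof.
  intros hl hm. apply NNPP. intros hn.
  set (bad := fun i (V : M -> Prop) => cle V (seg m) /\ (forall v, V v -> v << g i) /\
     forall y, y << g i -> exists v, V v /\ y << v).
  destruct (fun_choice_on (fun i => ~ bounding m (g i)) bad (inhabits (fun _ : M => True))) as [V hV].
  { intros i hi. apply NNPP. intros h. apply hi. intros V h1 h2. apply NNPP. intros h3. apply h.
    exists V. split; [|split]; auto. intros y hy. apply NNPP. intros h4. apply h3. exists y.
    split; auto. intros v hv h5. eauto. }
  destruct (bounding_projection m (fun i v => ~ bounding m (g i) /\ V i v) hm) as [d [y [h1 h2]]].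
  { intros i. destruct (classic (bounding m (g i))) as [h|h].
    - exists (fun _ _ => True). split; intros v; tauto.
    - eapply cle_trans; [apply cle_sub; intros v [_ hv]; exact hv|]. apply (hV i h). }
  destruct (ev_freq _ _ hn (ev_and _ _ (lub_gt g d hl) (proj2 hl y h2))) as [i [hi [k1 k2]]].
  destruct (hV i hi) as [_ [k3 k4]]. destruct (k4 _ k1) as [v [hv k5]].
  destruct (h1 i) as [_ [_ k6]]. apply (k6 v); auto.
  - apply ltW; auto.
  - eapply lt_le; [apply k3; exact hv|auto].
Qed.
End Projection.
End Increasing.

(** * A scale *)

(** Restrict [f] and its exact bound [g] to the coordinates [io c], chosen so sparsely that the
    earlier [L d] stay below an [m] for which [L c] is [bounding]. *)
Lemma scale_exists : exists (m0 : M) (F : K -> C -> M) (L : C -> M),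
  cle (full C) (seg m0) /\ inf (seg m0) /\
  (forall d c, F d c << L c) /\ (forall g d, g << d -> lts (F g) (F d)) /\
  (forall h, (forall c, h c << L c) -> exists d, lts h (F d)) /\
  (forall c, exists m, m0 <<= m /\ (forall d, d << c -> L d << m) /\ bounding m (L c)).
Proof.
  destruct base_exists as [m0 [m0_C m0_inf]]. destruct (mm_exists m0) as [mm [mm1 [mm2 mm3]]].
  destruct (fun_choice (fun i t => succ_card (mm i) t)) as [lam hlam].
  { intros i. apply succ_exists. apply (inf_ge m0); auto. }
  destruct (increasing_exists m0 mm lam) as [f [f1 [f2 f3]]]; auto.
  destruct (lub_function_exists m0 lam m0_inf m0_C f f1 f2 f3) as [g hg].
  destruct K_inh as [d0].
  destruct (wf_rec_choice C C (fun c w b => (forall d, d << c -> w d << b) /\ (exists y, y << g b) /\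
    exists m, m0 <<= m /\ (forall d, d << c -> g (w d) << m) /\ bounding m (g b)) C_inh) as [io hio].
  { intros c w w' b hw [h1 [h2 [m [h3 [h4 h5]]]]]. split; [|split; auto].
    - intros d hd. rewrite <- hw; auto.
    - exists m. split; auto. split; auto. intros d hd. rewrite <- hw; auto. }
  { intros c w _. destruct (small_bounded_M (seg c) (fun d => g (w d)) c (cle_refl _)) as [m1 hm1].
    destruct (max2 m0 m1) as [m [l1 l2]].
    destruct (small_bounded_C (seg c) w c (cle_refl _)) as [c1 hc1].
    destruct (ev_and _ _ (lub_bounding m0 lam m0_inf m0_C f f1 f2 f3 g m hg l1)
      (lub_gt f f2 g d0 hg)) as [i0 hi0].
    destruct (max2 i0 c1) as [b [b1 b2]]. exists b. destruct (hi0 b b1) as [k1 k2]. split; [|split].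
    - intros d hd. eapply lt_le; [apply hc1; exact hd|exact b2].
    - eauto.
    - exists m. split; [|split]; auto. intros d hd. eapply lt_le; [apply hm1; exact hd|auto]. }
  assert (io_inc : forall c d, d << c -> io d << io c) by (intros c; apply hio).
  assert (io_ge : forall c, c <<= io c).
  { intros c. induction c as [c IH] using (well_founded_ind lt_wf). intros h.
    exact (IH _ h (io_inc _ _ h)). }
  assert (io_inj : forall c d, io c = io d -> c = d).
  { intros c d e. apply NNPP. intros hn. destruct (neq_lt _ _ hn) as [h|h];
      apply io_inc in h; rewrite e in h; exact (lt_irr _ h). }
  assert (io_ev : forall P, ev P -> ev (fun c => P (io c))).
  { intros P [i0 h]. exists i0. intros c hc. apply h. eapply le_tr; eauto. }
  (* [F d] is [f d] along [io], changed to an arbitrary value below [g] where [f d] is not yet below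
     it. *)
  destruct (fun_choice (fun d (x : C -> M) => forall c, x c << g (io c) /\
     (f d (io c) << g (io c) -> x c = f d (io c)))) as [F hF].
  { intros d. apply (fun_choice (fun c y => y << g (io c) /\ (f d (io c) << g (io c) -> y = f d (io c)))).
    intros c. destruct (classic (f d (io c) << g (io c))) as [h|h]; [eauto|].
    destruct (hio c) as [_ [[y hy] _]]. exists y. tauto. }
  assert (F_ev : forall d, ev (fun c => F d c = f d (io c))).
  { intros d. generalize (io_ev _ (lub_gt f f2 g d hg)). apply ev_imp. intros c. apply hF. }
  exists m0, F, (fun c => g (io c)). split; [|split; [|split; [|split; [|split]]]]; auto.
  - intros d c. apply hF.
  - intros a d h. generalize (io_ev _ (f2 a d h)) (ev_and _ _ (F_ev a) (F_ev d)). apply ev_imp2.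
    intros c k [-> ->]. exact k.
  (* To use exactness, [h] is carried along [io] and extended by [f d0] off its range. *)
  - intros h hh. destruct (fun_choice (fun i y => (forall c, i = io c -> y = h c) /\
      ((forall c, i <> io c) -> y = f d0 i))) as [h' hh'].
    { intros i. destruct (classic (exists c, i = io c)) as [[c ->]|hn].
      - exists (h c). split; [intros c' e; apply io_inj in e; congruence|].
        intros hn. destruct (hn c eq_refl).
      - exists (f d0 i). split; auto. intros c e. exfalso. eauto. }
    destruct (lub_exact m0 lam m0_inf m0_C f f1 f2 f3 g h' hg) as [d hd].
    { generalize (lub_gt f f2 g d0 hg). apply ev_imp. intros i hi. destruct (hh' i) as [k1 k2].
      destruct (classic (exists c, i = io c)) as [[c ->]|hn].
      - rewrite (k1 c eq_refl). auto.
      - rewrite k2; auto. intros c e. eauto. }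
    exists d. generalize (io_ev _ hd) (F_ev d). apply ev_imp2. intros c k ->.
    destruct (hh' (io c)) as [k1 _]. rewrite (k1 c eq_refl) in k. exact k.
  - intros c. apply (hio c).
Qed.

Lemma ev_small {T : Type} (A : T -> Prop) (P : T -> C -> Prop) (xi : C) : cle A (seg xi) ->
  (forall x, A x -> ev (P x)) -> ev (fun i => forall x, A x -> P x i).
Proof.
  intros hA hP. destruct (fun_choice_on A _ C_inh hP) as [u hu].
  destruct (small_bounded_C A u xi hA) as [c hc]. exists c. intros i hi x ax.
  apply (hu x ax). eapply le_tr; [apply ltW, hc; exact ax|auto].
Qed.

Lemma ev_up (P : C -> Prop) : ev P -> ev (fun i => forall j, i <<= j -> P j).
Proof. intros [i0 h]. exists i0. intros i hi j hj. apply h. eapply le_tr; eauto. Qed.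

(** * Rectangles on which two blocks last cross at a prescribed coordinate *)

Section Crossing.
Context (m0 : M) (F : K -> C -> M) (L : C -> M).
Hypothesis m0_C : cle (full C) (seg m0).
Hypothesis m0_inf : inf (seg m0).
Hypothesis F_L : forall d c, F d c << L c.
Hypothesis F_inc : forall g d, g << d -> lts (F g) (F d).
Hypothesis F_dom : forall h, (forall c, h c << L c) -> exists d, lts h (F d).
Hypothesis L_bounding :
  forall c, exists m, m0 <<= m /\ (forall d, d << c -> L d << m) /\ bounding m (L c).

Definition last_cross (x y : K) (i : C) : Prop :=
  F y i <<= F x i /\ forall j, i << j -> F x j << F y j.

Lemma last_cross_fun : exists G : K -> K -> C, forall x y i, last_cross x y i -> G x y = i.
Proof.
  destruct (fun_choice (fun q c => forall i, last_cross (fst q) (snd q) i -> c = i)) as [G hG].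
  { intros [x y]. simpl. destruct (classic (exists i, last_cross x y i)) as [[i [h1 h2]]|hn].
    - exists i. intros j [k1 k2]. apply NNPP. intros hne. destruct (neq_lt _ _ hne) as [h|h].
      + exact (k1 (h2 j h)).
      + exact (h1 (k2 i h)).
    - destruct C_inh as [c]. exists c. intros i hi. exfalso. eauto. }
  exists (fun x y => G (x, y)). intros x y i h. apply (hG (x, y)); auto.
Qed.

Context (xi : C) (a : K -> K -> Prop).
Hypothesis a_disj : forall k k' x, k <> k' -> a k x -> a k' x -> False.
Hypothesis a_small : forall k, cle (a k) (seg xi).

(** If every block met the points up to [x], membership itself would be an injective relation from
    [K] to a set of size at most [|M|]. *)
Lemma block_above (x : K) : exists k, forall y, a k y -> x << y.
Proof.
  apply NNPP. intros hn. apply K_big.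
  apply (cle_trans _ (fun y => seg x y \/ y = x)); [|apply cle_add1_gen; auto].
  exists a. split.
  - intros k _. apply NNPP. intros hn'. apply hn. exists k. intros y hy.
    destruct (lt_or_le x y) as [h|h]; auto. exfalso. apply hn'. exists y. split; auto.
    apply le_lt_or_eq; auto.
  - intros k k' y _ _ _ h h'. apply NNPP. intros hne. exact (a_disj k k' y hne h h').
Qed.

(** Collect counterexamples [e] into one function [h]. Some [F d] dominates it, and a block above
    [d] exceeds [h] at all its points simultaneously from some coordinate on, since the block is
    small. *)
Lemma blocks_unbounded :
  ev (fun i => forall e, e << L i -> exists k, forall x, a k x -> e << F x i).
Proof.
  apply NNPP. intros hn. destruct K_inh as [d0].
  destruct (fun_choice (fun i e => e << L i /\
    ((exists e, e << L i /\ forall k, exists x, a k x /\ F x i <<= e) ->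
       forall k, exists x, a k x /\ F x i <<= e))) as [h hh].
  { intros i. destruct (classic (exists e, e << L i /\ forall k, exists x, a k x /\ F x i <<= e))
      as [[e [h1 h2]]|h]; [eauto|]. exists (F d0 i). split; [auto|tauto]. }
  destruct (F_dom h) as [d hd]; [intros; apply hh|].
  destruct (block_above d) as [k hk].
  destruct (ev_freq _ _ hn (ev_small (a k) (fun x i => h i << F x i) xi (a_small k)
    (fun x hx => lts_tr _ _ _ hd (F_inc _ _ (hk x hx))))) as [i [h1 h2]].
  apply h1. intros e he. apply NNPP. intros h3. destruct (hh i) as [_ h4].
  destruct h4 with (k := k) as [x [hx h5]].
  - exists e. split; auto. intros k'. apply NNPP. intros h6. apply h3. exists k'. intros x hx.
    destruct (lt_or_le e (F x i)) as [h7|h7]; auto. exfalso. eauto.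
  - exact (h5 (h2 x hx)).
Qed.

Lemma C_le_M : cle (full C) (full M).
Proof. eapply cle_trans; [exact m0_C|apply cle_sub; intros; exact I]. Qed.

Lemma small_le (m : M) (k : K) : m0 <<= m -> cle (a k) (seg m).
Proof.
  intros h. eapply cle_trans; [apply a_small|]. apply (cle_trans _ (full C));
    [apply cle_sub; intros; exact I|]. eapply cle_trans; [exact m0_C|apply seg_mono; auto].
Qed.

(** The upper block [k'] is fixed first, above everything relevant; the lower block depends on [i].
    It is high at [i], above all values of [k'], and at each later coordinate it stays below [h],
    which [k'] exceeds there. *)
Lemma blocks_cross :
  ev (fun i => exists k k', forall x y, a k x -> a k' y -> x << y /\ last_cross x y i).
Proof.
  destruct blocks_unbounded as [i0 hi0].
  destruct (fun_choice_on (fun q : C * M => i0 <<= fst q /\ snd q << L (fst q))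
    (fun q k => forall x, a k x -> snd q << F x (fst q)) K_inh) as [kk hkk].
  { intros [i e] [h1 h2]. simpl in *. apply hi0; auto. }
  (* [h j] bounds the values at [j] of all candidate blocks [kk (i, e)] with [i] below [j]. As [L i]
     is below [m], these are at most [|m|] values, and [L j] is [bounding] for [m]. *)
  destruct (fun_choice (fun j y => y << L j /\ forall q x, fst q << j -> snd q << L (fst q) ->
     a (kk q) x -> F x j <<= y)) as [h hh].
  { intros j. destruct (L_bounding j) as [m [h1 [h2 h3]]].
    assert (sq := square_seg M m (inf_mono _ _ m0_inf (seg_mono _ _ h1))).
    assert (hC : cle (full C) (seg m)) by (eapply cle_trans; [exact m0_C|apply seg_mono; auto]).
    destruct (h3 (fun v => exists q, prodS (full C) (seg m) q /\ exists x, a (kk q) x /\ v = F x j))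
      as [y [k1 k2]].
    - apply (cle_trans _ (prodS (prodS (full C) (seg m)) (seg m))).
      + apply (cle_family _ _ (fun q v => exists x, a (kk q) x /\ v = F x j)); [auto|].
        intros q _. eapply cle_trans; [apply cle_image|]. apply small_le; auto.
      + eapply cle_trans; [|exact sq]. apply cle_prod; [|apply cle_refl].
        eapply cle_trans; [|exact sq]. apply cle_prod; [auto|apply cle_refl].
    - intros v [q [_ [x [_ ->]]]]. auto.
    - exists y. split; auto. intros q x q1 q2 hx. apply k2. exists q. split; [|eauto].
      split; [exact I|]. eapply lt_tr; [exact q2|]. apply h2; auto. }
  destruct (F_dom h) as [d hd]; [intros; apply hh|].
  destruct (bounded_K (fun x => exists q, a (kk q) x) (fun x => x)) as [b hb].
  { apply (cle_trans _ (prodS (prodS (full C) (full M)) (full M))).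
    - apply (cle_family _ _ (fun q x => a (kk q) x)).
      + intros x [q hq]. exists q. split; auto. split; exact I.
      + intros q _. eapply cle_trans; [apply (small_le m0), le_refl|].
        apply cle_sub; intros; exact I.
    - eapply cle_trans; [|apply M_square]. apply cle_prod; [|apply cle_refl].
      eapply cle_trans; [|apply M_square]. apply cle_prod; [apply C_le_M|apply cle_refl]. }
  destruct (max2 d b) as [d' [l1 l2]]. destruct (block_above d') as [k' hk'].
  assert (hev := ev_up _ (ev_small (a k') (fun x i => h i << F x i) xi (a_small k')
    (fun x hx => lts_tr _ _ _ hd (F_inc _ _ (le_lt _ _ _ l1 (hk' x hx)))))).
  assert (hge : ev (fun i => i0 <<= i)) by (exists i0; auto).
  revert hev hge. apply ev_imp2. intros i hi hi0i.
  (* [e] bounds the small block [k'] at coordinate [i]; the lower block is then [kk (i, e)]. *)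
  destruct (L_bounding i) as [m [h1 [_ h3]]].
  destruct (h3 (fun v => exists y, a k' y /\ v = F y i)) as [e [he1 he2]].
  { eapply cle_trans; [apply cle_image|]. apply small_le; auto. }
  { intros v [y [_ ->]]. auto. }
  exists (kk (i, e)), k'. intros x y hx hy. split; [|split].
  - eapply lt_tr; [apply hb; eauto|]. eapply le_lt; [exact l2|]. auto.
  - eapply le_tr; [apply he2; eauto|]. apply ltW. apply (hkk (i, e)); simpl; auto.
  - intros j hj. eapply le_lt; [apply (hh j) with (q := (i, e)); simpl; eauto|].
    apply hi; auto. apply ltW; auto.
Qed.
End Crossing.

(** * Coding finite sequences of colours *)

Lemma pairing_exists : exists (pi : C -> C -> C) (un : C -> C * C), forall x y, un (pi x y) = (x, y).
Proof.
  destruct (cle_fun _ _ C_inh (square_full C C_inf C_init)) as [pi [_ hpi]].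
  destruct (fun_choice (fun c q => forall q', c = pi q' -> q = q')) as [un hun].
  { intros c. destruct (classic (exists q, c = pi q)) as [[q ->]|hn].
    - exists q. intros q' e. apply hpi; auto; split; exact I.
    - exists (c, c). intros q' e. exfalso. eauto. }
  exists (fun x y => pi (x, y)), un. intros x y. apply hun. reflexivity.
Qed.

(** The last crossing is read as a code of [delta], of a [z] listing the values of [zeta] below
    [n delta], and of a padding [w]; the colour is entry [p delta x y] of the list. *)
Lemma colouring_exists (n : C -> nat) (p : C -> K -> K -> nat) :
  (forall delta x y, x << y -> p delta x y < n delta) ->
  exists f : K -> K -> C, forall (delta xi : C) (a : K -> K -> Prop) (zeta : nat -> C),
    (forall k k' x, k <> k' -> a k x -> a k' x -> False) ->
    (forall k, cle (a k) (seg xi)) ->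
    exists k k', forall x y, a k x -> a k' y -> x << y /\ f x y = zeta (p delta x y).
Proof.
  intros Hp. destruct scale_exists as [m0 [F [L [s1 [s2 [s3 [s4 [s5 s6]]]]]]]].
  destruct (last_cross_fun F) as [G hG]. destruct pairing_exists as [pi [un hun]].
  set (dec := fix dec k z := match k with 0 => fst (un z) | S k => dec k (snd (un z)) end).
  assert (hdec : forall N (zeta : nat -> C), exists z, forall k, k < N -> dec k z = zeta k).
  { induction N; intros zeta.
    - destruct C_inh as [c]. exists c. intros; lia.
    - destruct (IHN (fun k => zeta (S k))) as [z hz]. exists (pi (zeta 0) z).
      intros [|k] hk; simpl; rewrite hun; simpl; auto. apply hz. lia. }
  exists (fun x y => let q := un (G x y) in dec (p (fst q) x y) (fst (un (snd q)))).
  intros delta xi a zeta hd hs. destruct (hdec (n delta) zeta) as [z hz].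
  destruct (blocks_cross m0 F L s1 s2 s3 s4 s5 s6 xi a hd hs) as [i0 hi0].
  (* The padding supplies [|C|] many codes for the same data, so one of them is not below [i0]. *)
  assert (hw : exists w, i0 <<= pi delta (pi z w)).
  { apply NNPP. intros hn. apply (C_init i0).
    apply (cle_fun_intro _ _ (fun w => pi delta (pi z w))).
    - intros w _. apply NNPP. intros h. eauto.
    - intros w w' _ _ e. apply (f_equal un) in e. rewrite !hun in e. injection e as e.
      apply (f_equal un) in e. rewrite !hun in e. congruence. }
  destruct hw as [w hw]. destruct (hi0 _ hw) as [k [k' hk]]. exists k, k'.
  intros x y hx hy. destruct (hk x y hx hy) as [h1 h2]. split; auto.
  rewrite (hG _ _ _ h2). simpl. rewrite hun. simpl. rewrite hun. simpl. apply hz. auto.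
Qed.

End Singular.

(** * Transfer to types compared by injections *)

Theorem theorem4p7 (M K C : Type) (ltM : M -> M -> Prop) (ltK : K -> K -> Prop)
    (ltC : C -> C -> Prop)
    (Hmu : infinite_cardinal ltM)
    (Hcf : is_cof ltM ltC)
    (Hsing : ~ inj M C)
    (Hsucc : is_successor_of M ltK)
    (n : C -> nat) (p : C -> K -> K -> nat)
    (Hp : forall delta al be, ltK al be -> p delta al be < n delta) :
  Pr1_seq ltK ltC n p.
Proof.
  destruct Hmu as [[Mwo M_init] M_inf]. destruct Hcf as [[Cwo C_init] [[h hcof] C_min]].
  destruct Hsucc as [Kwo [K_seg K_big]].
  destruct (colouring_exists (MkWO M ltM Mwo) (MkWO C ltC Cwo) (MkWO K ltK Kwo)) with (cofM := h)
    (n := n) (p := p) as [f hf]; auto.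
  - intros x hx. apply (M_init x). apply cle_inj_sigr. exact hx.
  - apply inj_cle. exact M_inf.
  - intros c hc. apply (C_init c). apply cle_inj_sigr. exact hc.
  - intros D u hu. apply inj_cle. apply (C_min D u). exact hu.
  - intros hc. apply Hsing. apply cle_inj. exact hc.
  - intros x. apply inj_cle_sigl. exact (K_seg x).
  - intros hc. apply K_big. apply cle_inj. exact hc.
  - exists f. intros delta xi a zeta _ hdisj hsmall.
    destruct (hf delta xi a zeta) as [i [j hij]].
    + exact hdisj.
    + intros k. apply inj_cle_sig. exact (hsmall k).
    + exists i, j. split; intros al be hal hbe; apply (hij al be hal hbe).
Qed.
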